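(* Let $n\ge 3$ be an integer, let $\ell$ be a positive integer and let $r_1,\dots,r_\ell$ be a sequence of positive integers. Assume that $\sum_{i=1}^{\ell}r_i\le n$; if $r_j=1$ for some $j$, assume additionally that $\sum_{i=1}^{\ell}r_i<n$. Then $Z^0(n,\ell;r_1,\dots,r_\ell)$ is a Zariski-open everywhere dense subset of $Z(n,\ell;r_1,\dots,r_\ell)$ that contains the polynomial $g(x)=x^n$.
   Context: $\mathbf{A}^n=\mathbb{C}^n$ denotes the affine space of all monic complex polynomials $g(x)=x^n+\sum_{i=0}^{n-1}a_ix^i$ of degree $n$, identified with their coefficient vectors $(a_0,\dots,a_{n-1})\in\mathbb{C}^n$. For a positive integer $r$, $g^{\circ r}$ denotes the $r$-fold composition of $g$ with itself. $Z_{n,r}\subset\mathbf{A}^n$ is the (Zariski-open, dense) set of all monic degree $n$ polynomials $g$ such that $g^{\circ r}(x)-x$ has no multiple roots. $Z(n,\ell;r_1,\dots,r_\ell):=\bigcap_{i=1}^{\ell}Z_{n,r_i}$; it is a Zariski-open subset of $\mathbf{A}^n$ containing $x^n$. Let $g_0\in Z(n,\ell;r_1,\dots,r_\ell)$. If $\beta\in\mathbb{C}$ is a periodic point of $z\mapsto g_0(z)$ of exact period $r=r_i$, then $\beta$ is a simple root of $g_0^{\circ r}(x)-x$, so by the implicit function theorem it extends uniquely to a holomorphic function $g\mapsto\beta(g)$ of the coefficients $(a_0,\dots,a_{n-1})$ in a neighbourhood of $g_0$ with $g^{\circ r}(\beta(g))=\beta(g)$ and $\beta(g_0)=\beta$.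 Define, near $g_0$, the holomorphic function $\mathrm{Mult}_{\beta,r}(g):=[g^{\circ r}]'(\beta(g))$, and let $\mathrm{grad}(\mathrm{Mult}_{\beta,r})|_{g_0}\in\mathbb{C}^n$ be its vector of partial derivatives with respect to $a_0,\dots,a_{n-1}$ at $g_0$. $Z^0(n,\ell;r_1,\dots,r_\ell)$ is the set of all $g_0\in Z(n,\ell;r_1,\dots,r_\ell)$ such that, for every choice of $\beta_1,\dots,\beta_\ell\in\mathbb{C}$ with $\beta_i$ a periodic point of $z\mapsto g_0(z)$ of exact period $r_i$ for each $i$ and with $\beta_1,\dots,\beta_\ell$ lying in pairwise distinct orbits of $z\mapsto g_0(z)$, the $\ell$ vectors $\mathrm{grad}(\mathrm{Mult}_{\beta_i,r_i})|_{g_0}$ ($1\le i\le\ell$) are linearly independent in $\mathbb{C}^n$. *)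

(* Defs.v *)
From HB Require Import structures.
From mathcomp Require Import all_boot all_order all_algebra.
From mathcomp Require Import complex.
From mathcomp Require Import all_classical all_reals all_analysis.
From mathcomp Require mpoly.

Set Implicit Arguments.
Unset Strict Implicit.
Unset Printing Implicit Defensive.

Import Order.TTheory GRing.Theory Num.Theory.
Import numFieldNormedType.Exports.

Local Open Scope classical_set_scope.
Local Open Scope complex_scope.
Local Open Scope ring_scope.

(* R[i] with the topology and norm given by the modulus, as a normed space over
   itself, so that derivatives of maps 'rV[R[i]]_n -> R[i] are complex ones. *)
HB.instance Definition _ (R : realType) := NormedModule.copy R[i] R[i]^o.

Section PolynomialMaps.
Variables (R : realType) (n : nat).
Local Notation C := R[i].

Definition monic_of (a : 'rV[C]_n) : {poly C} :=
  'X^n + \sum_(i < n) a 0 i *: 'X^i.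

Definition iter_poly (g : {poly C}) (r : nat) : {poly C} :=
  iter r (fun p => g \Po p) 'X.

Definition no_multiple_root (p : {poly C}) : Prop :=
  forall x : C, ~~ (('X - x%:P) ^+ 2 %| p).

Definition exact_period (g : {poly C}) (r : nat) (x : C) : Prop :=
  [/\ (0 < r)%N, iter r (horner g) x = x
    & forall k, (0 < k < r)%N -> iter k (horner g) x <> x].

Definition orbit_of (g : {poly C}) (x : C) : set C :=
  range (fun k => iter k (horner g) x).

Definition zariski_closed (F : set 'rV[C]_n) : Prop :=
  exists S : set (mpoly.mpoly n C),
    F = [set a | forall p, S p -> mpoly.meval (fun i => a 0 i) p = 0].

Definition zariski_open (U : set 'rV[C]_n) : Prop := zariski_closed (~` U).

Definition zariski_open_in (Z A : set 'rV[C]_n) : Prop :=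
  exists2 U, zariski_open U & A = Z `&` U.

Definition zariski_dense_in (Z A : set 'rV[C]_n) : Prop :=
  A `<=` Z /\
  forall U, zariski_open U -> Z `&` U !=set0 -> A `&` U !=set0.

Definition Zr (r : nat) : set 'rV[C]_n :=
  [set a | no_multiple_root (iter_poly (monic_of a) r - 'X)].

Definition Zset (l : nat) (r : 'I_l -> nat) : set 'rV[C]_n :=
  \bigcap_(i in [set: 'I_l]) Zr (r i).

(* Complex differentiability on a neighbourhood of a0 is holomorphy near a0. *)
Definition is_branch (a0 : 'rV[C]_n) (r : nat) (beta : C)
    (b : 'rV[C]_n -> C) : Prop :=
  b a0 = beta /\
  \forall a \near a0, differentiable b a /\
                      (iter_poly (monic_of a) r).[b a] = b a.

(* When beta is a simple root of g_0^{\circ r}(x) - x, a holomorphic branch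
   exists by the implicit function theorem and its germ at a0 is unique, so
   neither the default value nor the choice made by xget affects the gradient
   of Mult below. *)
Definition branch (a0 : 'rV[C]_n) (r : nat) (beta : C) : 'rV[C]_n -> C :=
  xget (fun=> beta) [set b | is_branch a0 r beta b].

Definition Mult (a0 : 'rV[C]_n) (r : nat) (beta : C) (a : 'rV[C]_n) : C :=
  (iter_poly (monic_of a) r)^`().[branch a0 r beta a].

Definition gradMult (a0 : 'rV[C]_n) (r : nat) (beta : C) : 'rV[C]_n :=
  \row_(k < n) 'D_(delta_mx 0 k) (Mult a0 r beta) a0.

Definition Z0set (l : nat) (r : 'I_l -> nat) : set 'rV[C]_n :=
  [set a | Zset r a /\
    forall beta : 'I_l -> C,
      (forall i, exact_period (monic_of a) (r i) (beta i)) ->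
      (forall i j, i != j ->
         orbit_of (monic_of a) (beta i) <> orbit_of (monic_of a) (beta j)) ->
      row_free (\matrix_(i < l) gradMult a (r i) (beta i))].

End PolynomialMaps.

Arguments Zset R n {l} r.
Arguments Z0set R n {l} r.

(* Main.v *)
(* Write g_a for the monic polynomial with coefficient vector a, and let beta be
   a point of period r of g_a, simple as a root of f_a = g_a^r(x) - x.
   - Openness. The gradient of the multiplier M at beta, multiplied by 1 - M
     (nonzero because beta is a simple root), is polynomial in (a, beta).  Since
     f_a has no multiple roots, two of its roots x, y differ if and only if the
     difference quotient of f_a vanishes at (x, y), so "exact period" and
     "distinct orbits" are polynomial equations on tuples of roots.  Hence the
     complement of Z0 in Z is the projection of an algebraic set along the finite
     map defined by the monic polynomials f_a, and such projections are closed.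
   - At x^n, an orbit beta_j <> 0 of exact period r has gradient with k-th entry
     c (k - n) sum_j beta_j^(k-n), c <> 0, and the fixed point 0 has gradient e_1.
     Up to the factors k - n, a linear dependence says that a combination of
     evaluations at distinct nonzero points, and of h'(0), kills all polynomials
     h of degree < n; the bound on sum r_i excludes this.
   - Density follows from these two points by irreducibility of affine space. *)
Require Import Defs.
From mathcomp Require Import all_boot all_order all_algebra.
From mathcomp Require Import complex.
From mathcomp Require Import all_classical all_reals all_analysis.
From mathcomp Require Import ring.
From mathcomp Require mpoly.

Set Implicit Arguments.
Unset Strict Implicit.
Unset Printing Implicit Defensive.

Import Order.TTheory GRing.Theory Num.Theory.
Import numFieldNormedType.Exports.
Import (canonicals) mpoly.

Local Open Scope classical_set_scope.
Local Open Scope complex_scope.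
Local Open Scope ring_scope.

(** * Polynomial functions and elimination *)

Section PolynomialFunctions.
Variable K : closedFieldType.
Implicit Types (m : nat) (v w : nat -> K) (p : (nat -> K) -> K).

(** Polynomial functions of the first m coordinates of an infinite sequence. Using [nat -> K] for
    every m lets coordinates be added or eliminated without any change of type. *)
Inductive polyfun m : ((nat -> K) -> K) -> Prop :=
| polyfunC c : polyfun m (fun=> c)
| polyfunX i : (i < m)%N -> polyfun m (fun v => v i)
| polyfunD p q : polyfun m p -> polyfun m q -> polyfun m (fun v => p v + q v)
| polyfunM p q : polyfun m p -> polyfun m q -> polyfun m (fun v => p v * q v).

Lemma polyfun_ext m p q : (forall v, p v = q v) -> polyfun m q -> polyfun m p.
Proof. by move=> pq; have -> : p = q by apply: funext. Qed.

Lemma polyfunN m p : polyfun m p -> polyfun m (fun v => - p v).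
Proof.
move=> pP; apply: (@polyfun_ext _ _ (fun v => -1 * p v)) => [v|].
  by rewrite mulN1r.
by apply: polyfunM => //; apply: polyfunC.
Qed.

Lemma polyfunB m p q :
  polyfun m p -> polyfun m q -> polyfun m (fun v => p v - q v).
Proof. by move=> pP qP; apply: polyfunD => //; apply: polyfunN. Qed.

Lemma polyfun_sum m (I : Type) (s : seq I) (P : pred I) F :
  (forall i, polyfun m (F i)) ->
  polyfun m (fun v => \sum_(i <- s | P i) F i v).
Proof.
move=> FP; elim: s => [|i s IHs].
  by apply: polyfun_ext (polyfunC m 0) => v; rewrite big_nil.
case Pi: (P i); last by apply: polyfun_ext IHs => v; rewrite big_cons Pi.
by apply: polyfun_ext (polyfunD (FP i) IHs) => v; rewrite big_cons Pi.
Qed.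

Lemma polyfun_prod m (I : Type) (s : seq I) (P : pred I) F :
  (forall i, polyfun m (F i)) ->
  polyfun m (fun v => \prod_(i <- s | P i) F i v).
Proof.
move=> FP; elim: s => [|i s IHs].
  by apply: polyfun_ext (polyfunC m 1) => v; rewrite big_nil.
case Pi: (P i); last by apply: polyfun_ext IHs => v; rewrite big_cons Pi.
by apply: polyfun_ext (polyfunM (FP i) IHs) => v; rewrite big_cons Pi.
Qed.

Lemma polyfun_exp m p k : polyfun m p -> polyfun m (fun v => p v ^+ k).
Proof.
move=> pP; elim: k => [|k IHk]; first exact: polyfun_ext (polyfunC m 1).
by apply: polyfun_ext (polyfunM pP IHk) => v; rewrite exprS.
Qed.

Lemma polyfun_leq m m' p : (m <= m')%N -> polyfun m p -> polyfun m' p.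
Proof.
move=> mm'; elim=> [c|i im|*|*]; first exact: polyfunC.
- by apply: polyfunX; apply: leq_trans mm'.
- exact: polyfunD.
- exact: polyfunM.
Qed.

Lemma polyfun_eq m p v w :
  polyfun m p -> (forall i, (i < m)%N -> v i = w i) -> p v = p w.
Proof. by move=> pP vw; elim: pP => //= [? ? _ -> _ ->|? ? _ -> _ ->]. Qed.

Lemma polyfun_det m d (M : (nat -> K) -> 'M[K]_d) :
  (forall i j, polyfun m (fun v => M v i j)) -> polyfun m (fun v => \det (M v)).
Proof.
move=> MP; apply: polyfun_sum => s.
by apply: polyfunM; [exact: polyfunC|apply: polyfun_prod => i; apply: MP].
Qed.

(** Univariate polynomials whose coefficients vary polynomially. The uniform bound on the size turns
    evaluation and composition into sums of fixed length. *)
Definition polyfam m (F : (nat -> K) -> {poly K}) : Prop :=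
  (exists d, forall v, (size (F v) <= d)%N) /\
  forall i, polyfun m (fun v => (F v)`_i).

Lemma polyfam_ext m F G : (forall v, F v = G v) -> polyfam m G -> polyfam m F.
Proof. by move=> FG; have -> : F = G by apply: funext. Qed.

Lemma polyfamC m p : polyfun m p -> polyfam m (fun v => (p v)%:P).
Proof.
move=> pP; split; first by exists 1%N => v; apply: size_polyC_leq1.
case=> [|i]; first by apply: polyfun_ext pP => v; rewrite coefC.
by apply: polyfun_ext (polyfunC m 0) => v; rewrite coefC.
Qed.

Lemma polyfam_cst m (f : {poly K}) : polyfam m (fun=> f).
Proof. by split; [exists (size f)|move=> i; apply: polyfunC]. Qed.

Lemma polyfamD m F G :
  polyfam m F -> polyfam m G -> polyfam m (fun v => F v + G v).
Proof.
move=> [[d Fd] Fc] [[e Ge] Gc]; split.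
  exists (maxn d e) => v; apply: leq_trans (size_polyD _ _) _.
  by rewrite geq_max !leq_max Fd Ge orbT.
move=> i; apply: polyfun_ext (polyfunD (Fc i) (Gc i)) => v.
by rewrite coefD.
Qed.

Lemma polyfamM m F G :
  polyfam m F -> polyfam m G -> polyfam m (fun v => F v * G v).
Proof.
move=> [[d Fd] Fc] [[e Ge] Gc]; split.
  exists (d + e)%N => v; apply: leq_trans (size_polyMleq _ _) _.
  by apply: leq_trans (leq_pred _) _; apply: leq_add.
move=> i; under [X in polyfun _ X]funext => v do rewrite coefM.
by apply: polyfun_sum => j; apply: polyfunM.
Qed.

Lemma polyfamN m F : polyfam m F -> polyfam m (fun v => - F v).
Proof.
move=> FP; apply: polyfam_ext (polyfamM (polyfam_cst m (-1)) FP) => v.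
by rewrite mulN1r.
Qed.

Lemma polyfam_sum m (I : Type) (s : seq I) (P : pred I) F :
  (forall i, polyfam m (F i)) ->
  polyfam m (fun v => \sum_(i <- s | P i) F i v).
Proof.
move=> FP; elim: s => [|i s IHs].
  by apply: polyfam_ext (polyfam_cst m 0) => v; rewrite big_nil.
case Pi: (P i); last by apply: polyfam_ext IHs => v; rewrite big_cons Pi.
by apply: polyfam_ext (polyfamD (FP i) IHs) => v; rewrite big_cons Pi.
Qed.

Lemma polyfam_exp m F k : polyfam m F -> polyfam m (fun v => F v ^+ k).
Proof.
move=> FP; elim: k => [|k IHk]; first exact: polyfam_cst.
by apply: polyfam_ext (polyfamM FP IHk) => v; rewrite exprS.
Qed.

Lemma polyfam_deriv m F : polyfam m F -> polyfam m (fun v => (F v)^`()).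
Proof.
move=> [[d Fd] Fc]; split.
  by exists d => v; apply: leq_trans (Fd v); apply: leq_trans (size_poly _ _) (leq_pred _).
move=> i; apply: polyfun_ext (polyfunM (Fc i.+1) (polyfunC m i.+1%:R)) => v.
by rewrite coef_deriv mulr_natr.
Qed.

Lemma polyfam_comp m F G :
  polyfam m F -> polyfam m G -> polyfam m (fun v => F v \Po G v).
Proof.
move=> [[d Fd] Fc] GP.
apply: (@polyfam_ext _ _ (fun v => \sum_(i < d) ((F v)`_i)%:P * (G v ^+ i))).
  move=> v; rewrite /comp_poly (@horner_coef_wide _ d) ?size_map_polyC //.
  by apply: eq_bigr => i _; rewrite coef_map.
apply: polyfam_sum => i; apply: polyfamM; last exact: polyfam_exp.
exact: polyfamC.
Qed.

Lemma polyfam_horner m F p :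
  polyfam m F -> polyfun m p -> polyfun m (fun v => (F v).[p v]).
Proof.
move=> [[d Fd] Fc] pP.
apply: (@polyfun_ext _ _ (fun v => \sum_(i < d) (F v)`_i * (p v ^+ i))).
  by move=> v; rewrite (horner_coef_wide _ (Fd v)).
apply: polyfun_sum => i; apply: polyfunM; first exact: Fc.
exact: polyfun_exp.
Qed.

Lemma polyfam_leq m m' F : (m <= m')%N -> polyfam m F -> polyfam m' F.
Proof. by move=> mm' [dF cF]; split=> // i; apply: polyfun_leq (cF i). Qed.

Lemma polyfam_eq m F v w :
  polyfam m F -> (forall i, (i < m)%N -> v i = w i) -> F v = F w.
Proof. by move=> [_ FP] vw; apply/polyP => i; apply: (polyfun_eq (FP i)). Qed.

(** Collects the powers of the last coordinate, which is the one to be eliminated. *)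
Lemma polyfun_polyfam m p :
  polyfun m.+1 p -> exists2 F, polyfam m F & forall v, p v = (F v).[v m].
Proof.
elim=> [c|i im|p1 p2 _ [F1 F1P p1E] _ [F2 F2P p2E]
       |p1 p2 _ [F1 F1P p1E] _ [F2 F2P p2E]].
- by exists (fun=> c%:P) => [|v]; [apply: polyfam_cst|rewrite hornerC].
- have [->|neq_im] := eqVneq i m.
    by exists (fun=> 'X) => [|v]; [apply: polyfam_cst|rewrite hornerX].
  exists (fun v => (v i)%:P) => [|v]; last by rewrite hornerC.
  by apply/polyfamC/polyfunX; rewrite ltn_neqAle neq_im.
- exists (fun v => F1 v + F2 v) => [|v]; first exact: polyfamD.
  by rewrite hornerD p1E p2E.
- exists (fun v => F1 v * F2 v) => [|v]; first exact: polyfamM.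
  by rewrite hornerM p1E p2E.
Qed.

(** * Elimination through companion matrices *)

(** The dimension is a parameter separate from [size f], so that a whole family of polynomials
    shares one matrix type. *)
Definition companion d (f : {poly K}) : 'M[K]_d :=
  \matrix_(i, j) if i == d.-1 :> nat then - f`_j else (i.+1 == j :> nat)%:R.

Lemma char_poly_companion d (f : {poly K}) :
  f \is monic -> size f = d.+1 -> char_poly (companion d f) = f.
Proof.
move=> fm sf; have -> : d = (size f).-1 by rewrite sf.
exact: companionmxK.
Qed.

(** Without a common root, f and q are coprime, and a Bezout relation evaluated at the companion
    matrix, where f vanishes, inverts q there. A common root is an eigenvalue, and its eigenvector
    is killed by q of the matrix. *)
Lemma det_horner_companion_eq0 d (f q : {poly K}) :
  f \is monic -> size f = d.+2 ->
  \det (horner_mx (companion d.+1 f) q) = 0 <-> exists2 x, root f x & root q x.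
Proof.
move=> fm sf; set M := companion _ _.
have fE : char_poly M = f by apply: char_poly_companion.
have CH : horner_mx M f = 0 by rewrite -fE; apply: Cayley_Hamilton.
split=> [detq|[x fx /factor_theorem[q1 ->]]].
  apply: contrapT => noroot.
  have /Bezout_eq1_coprimepP[[u w] /= uw] : coprimep f q.
    apply: Pdiv.ClosedField.root_coprimep => x fx.
    by apply/negP => qx; apply: noroot; exists x.
  have : horner_mx M w * horner_mx M q = 1.
    rewrite -rmorphM -(rmorph1 (horner_mx M)) -uw rmorphD !rmorphM /=.
    by rewrite CH mulr0 add0r.
  move=> /(congr1 determinant); rewrite -mulmxE det_mulmx detq mulr0 det1.
  by move=> /esym/eqP; rewrite oner_eq0.
have /eigenvalueP[v vM v0] : eigenvalue M x by rewrite eigenvalue_root_char fE.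
apply/eqP/det0P; exists v => //.
rewrite [q1 * _]mulrC rmorphM -mulmxE mulmxA /= rmorphB /= horner_mx_X horner_mx_C.
by rewrite mulmxBr vM mul_mx_scalar subrr mul0mx.
Qed.

Lemma polyfun_det_horner m d F G :
  polyfam m F -> polyfam m G ->
  polyfun m (fun v => \det (horner_mx (companion d.+1 (F v)) (G v))).
Proof.
move=> [_ Fc] [[e Ge] Gc].
have CP i j : polyfun m (fun v => companion d.+1 (F v) i j).
  apply: (@polyfun_ext _ _ (fun v => if i == d :> nat then - (F v)`_j
                                  else (i.+1 == j :> nat)%:R)) => [v|].
    by rewrite mxE.
  by case: (_ == d :> nat); [exact: polyfunN|exact: polyfunC].
have XP k i j : polyfun m (fun v => (companion d.+1 (F v) ^+ k) i j).
  elim: k i j => [|k IHk] i j.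
    by apply: polyfun_ext (polyfunC m ((1 : 'M[K]_d.+1) i j)).
  apply: (@polyfun_ext _ _ (fun v => \sum_l companion d.+1 (F v) i l *
                                   (companion d.+1 (F v) ^+ k) l j)) => [v|].
    by rewrite exprS -mulmxE mxE.
  by apply: polyfun_sum => l; apply: polyfunM.
apply: polyfun_det => i j.
apply: (@polyfun_ext _ _ (fun v => \sum_(k < e) (G v)`_k *
                                 (companion d.+1 (F v) ^+ k) i j)) => [v|].
  rewrite /horner_mx /horner_morph (@horner_coef_wide _ e).
    rewrite summxE; apply: eq_bigr => k _; rewrite coef_map /=.
    by rewrite -mulmxE mul_scalar_mx mxE.
  exact: leq_trans (size_poly _ _) (Ge v).
by apply: polyfun_sum => k; apply: polyfunM; [apply: Gc|apply: XP].
Qed.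

(** Closedness by separation: no system of equations has to be chosen, and intersections are
    immediate. *)
Definition polyclosed m (W : set (nat -> K)) : Prop :=
  forall v, ~ W v ->
    exists p, [/\ polyfun m p, forall w, W w -> p w = 0 & p v <> 0].

Definition upd (v : nat -> K) m (x : K) : nat -> K :=
  fun i => if i == m then x else v i.

(** Separating functions of single points are merged one by one into [p + t * p1]. Each point
    excludes at most one value of t, and an algebraically closed field has others. *)
Lemma polyclosed_separate m W (u : K -> nat -> K) (s : seq K) :
  polyclosed m W -> (forall x, x \in s -> ~ W (u x)) ->
  exists p, [/\ polyfun m p, forall w, W w -> p w = 0 &
                forall x, x \in s -> p (u x) != 0].
Proof.
move=> Wcl; elim: s => [|x s IHs] sW.
  by exists (fun=> 0); split => //; apply: polyfunC.
have [y ys|p [pP pW ps]] := IHs; first by apply: sW; rewrite in_cons ys orbT.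
have [|p1 [p1P p1W /eqP p1x]] := Wcl (u x); first by apply: sW; exact: mem_head.
have [p0|px] := eqVneq (p (u x)) 0; last first.
  by exists p; split => // y; rewrite in_cons => /orP[/eqP->|/ps].
(* The value of the combination at [u y], as a polynomial in the parameter t. *)
pose g y : {poly K} := (p (u y))%:P + 'X * (p1 (u y))%:P.
have g0 y : y \in x :: s -> g y != 0.
  rewrite in_cons => yxs; apply/eqP => g0.
  have c0 : (g y)`_0 = p (u y) by rewrite /g coefD coefC coefXM addr0.
  have c1 : (g y)`_1 = p1 (u y) by rewrite /g coefD coefC coefXM coefC add0r.
  case/orP: yxs => [/eqP yx|/ps/eqP]; last by rewrite -c0 g0 coef0.
  by move: p1x; rewrite -yx -c1 g0 coef0 eqxx.
have : \prod_(y <- x :: s) g y != 0.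
  by rewrite prodf_seq_neq0; apply/allP => y ys /=; apply: g0.
move=> /closed_nonrootP[t]; rewrite /root horner_prod prodf_seq_neq0.
move=> /allP gt; exists (fun v => p v + t * p1 v); split.
- by apply/polyfunD => //; apply/polyfunM => //; apply: polyfunC.
- by move=> w Ww; rewrite pW // p1W // mulr0 addr0.
- by move=> y /gt /=; rewrite /g hornerD hornerC hornerM hornerX hornerC.
Qed.

(* The norm of q along the finite extension defined by F, here the determinant
   of q at the companion matrix, replaces the coordinate m by an eliminant. *)
Lemma polyclosed_elim m d F W :
  polyfam m F -> (forall v, F v \is monic) -> (forall v, size (F v) = d.+2) ->
  polyclosed m.+1 W ->
  polyclosed m [set v | exists2 x, root (F v) x & W (upd v m x)].
Proof.
move=> FP Fm sF Wcl v nWv.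
have [rs Frs] := closed_field_poly_normal (F v).
have rsF x : x \in rs = root (F v) x.
  by rewrite Frs (monicP (Fm v)) scale1r root_prod_XsubC.
(* One p has to be nonzero on the whole fibre over v, so that the eliminant does not vanish at v. *)
have [x xrs Wx|p [pP pW prs]] := @polyclosed_separate _ _ (upd v m) rs Wcl.
  by apply: nWv; exists x => //; rewrite -rsF.
have [q qP pE] := polyfun_polyfam pP.
have updE w x : p (upd w m x) = (q w).[x].
  rewrite pE {2}/upd eqxx; congr (_.[_]); apply: (polyfam_eq qP) => i im.
  by rewrite /upd ltn_eqF.
exists (fun v => \det (horner_mx (companion d.+1 (F v)) (q v))); split.
- exact: polyfun_det_horner.
- move=> w [x Fx Wx]; apply/(det_horner_companion_eq0 _ (Fm w) (sF w)).
  by exists x => //; rewrite /root -updE pW.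
- move=> /(det_horner_companion_eq0 _ (Fm v) (sF v))[x].
  by rewrite -rsF => /prs; rewrite updE => /negP.
Qed.

(** The roots are eliminated one at a time, the last one first. Each [F i] involves only the first m
    coordinates, so it is unaffected by changes in the later ones. *)
Lemma polyclosed_exists m j W (F : nat -> (nat -> K) -> {poly K}) :
  (forall i, (i < j)%N -> [/\ polyfam m (F i), forall v, F i v \is monic &
     exists d, forall v, size (F i v) = d.+2]) ->
  polyclosed (m + j) W ->
  polyclosed m [set v | exists w, [/\ forall i, (i < m)%N -> w i = v i,
     forall i, (i < j)%N -> root (F i v) (w (m + i)%N) & W w]].
Proof.
elim: j W => [|j IHj] W FP Wcl v nWv.
  have nv : ~ W v by move=> Wv; apply: nWv; exists v.
  rewrite addn0 in Wcl; have [p [pP pW pv]] := Wcl v nv.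
  exists p; split => // w [w' [w'E _ /pW p0]].
  by rewrite -(polyfun_eq pP w'E).
have [FjP Fjm [d sFj]] := FP j (ltnSn j).
have FjP' : polyfam (m + j) (F j) by apply: polyfam_leq FjP; apply: leq_addr.
rewrite addnS in Wcl.
have cl := polyclosed_elim FjP' Fjm sFj Wcl.
have {IHj cl} := IHj _ (fun i ij => FP i (ltnW ij)) cl.
have FE i (w w' : nat -> K) : (i <= j)%N ->
    (forall i, (i < m)%N -> w i = w' i) -> F i w = F i w'.
  by move=> ij ww'; have [FiP _ _] := FP i ij; apply: (polyfam_eq FiP).
move=> /(_ v)[|p [pP pW pv]].
  move=> [w [wv Fw [x Fx Wx]]]; apply: nWv; exists (upd w (m + j) x); split=> //.
    move=> i im; rewrite /upd ltn_eqF ?wv //.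
    by apply: leq_trans im (leq_addr _ _).
  move=> i; rewrite ltnS leq_eqVlt /upd eqn_add2l => /orP[/eqP ->|ij].
    by rewrite eqxx (FE _ _ w) // => k km; rewrite wv.
  by rewrite ltn_eqF // Fw.
exists p; split => // w [w' [w'w Fw' Ww']]; apply: pW; exists w'; split=> //.
  by move=> i ij; apply/Fw'/ltnW.
exists (w' (m + j)%N); first by rewrite (FE _ _ w) ?Fw'.
suff -> : upd w' (m + j) (w' (m + j)%N) = w' by [].
by apply: funext => i; rewrite /upd; case: eqP => // ->.
Qed.

(** * Irreducibility of affine space and the passage to [mpoly] *)

Lemma polyfun_line m p v w : polyfun m p ->
  exists q : {poly K}, forall t, p (fun i => v i + t * (w i - v i)) = q.[t].
Proof.
elim=> [c|i _|p1 p2 _ [q1 q1E] _ [q2 q2E]|p1 p2 _ [q1 q1E] _ [q2 q2E]].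
- by exists c%:P => t; rewrite hornerC.
- by exists ((v i)%:P + 'X * (w i - v i)%:P) => t; rewrite !hornerE.
- by exists (q1 + q2) => t; rewrite hornerD q1E q2E.
- by exists (q1 * q2) => t; rewrite hornerM q1E q2E.
Qed.

(** On the line from v1 to v2 both functions become univariate polynomials, nonzero because of their
    values at t = 0 and t = 1. Their product has a nonroot. *)
Lemma polyfun_common_nonzero m p1 p2 v1 v2 :
  polyfun m p1 -> polyfun m p2 -> p1 v1 != 0 -> p2 v2 != 0 ->
  exists v, p1 v != 0 /\ p2 v != 0.
Proof.
move=> p1P p2P p1v p2v.
have [q1 q1E] := polyfun_line v1 v2 p1P.
have [q2 q2E] := polyfun_line v1 v2 p2P.
have q1_0 : q1 != 0.
  apply: contraNneq p1v => q10; have := q1E 0; rewrite q10 horner0 => <-.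
  by apply/eqP; congr p1; apply: funext => i; rewrite mul0r addr0.
have q2_0 : q2 != 0.
  apply: contraNneq p2v => q20; have := q2E 1; rewrite q20 horner0 => <-.
  by apply/eqP; congr p2; apply: funext => i; rewrite mul1r addrC subrK.
have /closed_nonrootP[t] : q1 * q2 != 0 by rewrite mulf_neq0.
rewrite rootM negb_or => /andP[q1t q2t].
by exists (fun i => v1 i + t * (v2 i - v1 i)); rewrite q1E q2E.
Qed.

Lemma polyfun_mpoly m p : polyfun m p ->
  exists P : mpoly.mpoly m K, forall v, p v = mpoly.meval (fun i => v i) P.
Proof.
elim=> [c|i im|p1 p2 _ [q1 q1E] _ [q2 q2E]|p1 p2 _ [q1 q1E] _ [q2 q2E]].
- by exists (mpoly.mpolyC m c) => v; rewrite mpoly.mevalC.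
- exists (mpoly.mpolyX K (mpoly.mnm1 (Ordinal im))) => v.
  by rewrite mpoly.mevalXU.
- by exists (q1 + q2) => t; rewrite mpoly.mevalD q1E q2E.
- by exists (q1 * q2) => t; rewrite mpoly.mevalM q1E q2E.
Qed.

Lemma mpoly_polyfun m (P : mpoly.mpoly m K) :
  polyfun m (fun v => mpoly.meval (fun i => v i) P).
Proof.
under [X in polyfun _ X]funext => v do rewrite mpoly.mevalE.
apply: polyfun_sum => u; apply: polyfunM; first exact: polyfunC.
by apply: polyfun_prod => i; apply: polyfun_exp; apply: polyfunX.
Qed.

End PolynomialFunctions.

(** * Differentiation *)

Section Derivation.
Variables (K : numFieldType) (n : nat).
Implicit Types (a : 'rV[K]_n) (b : 'rV[K]_n -> K) (k : 'I_n).

Lemma is_derive_mul a v (f g : 'rV[K]_n -> K) df dg :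
  is_derive a v f df -> is_derive a v g dg ->
  is_derive a v (fun x => f x * g x) (f a * dg + g a * df).
Proof. by move=> fP gP; apply: is_derive_eq (is_deriveM fP gP) _. Qed.

Lemma is_derive_add a v (f g : 'rV[K]_n -> K) df dg :
  is_derive a v f df -> is_derive a v g dg ->
  is_derive a v (fun x => f x + g x) (df + dg).
Proof. by move=> fP gP; apply: is_derive_eq (is_deriveD fP gP) _. Qed.

Lemma is_derive_ext a v (f g : 'rV[K]_n -> K) df dg :
  (forall x, f x = g x) -> df = dg -> is_derive a v g dg -> is_derive a v f df.
Proof. by move=> fg ->; have -> : f = g by apply: funext. Qed.

Lemma is_derive_horner a v b (db : K) (p : {poly K}) : is_derive a v b db ->
  is_derive a v (fun x => p.[b x]) (p^`().[b a] * db).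
Proof.
move=> bP; elim/poly_ind: p => [|p c IHp].
  apply: is_derive_ext (is_derive_cst (0 : K) a v) => [x|]; first by rewrite horner0.
  by rewrite deriv0 horner0 mul0r.
apply: is_derive_ext (is_derive_add (is_derive_mul IHp bP) (is_derive_cst (c : K) a v)).
  by move=> x; rewrite !hornerE.
rewrite derivD derivM derivX derivC mulr1 addr0 !hornerE /=.
by rewrite mulrDl addrC [b a * _]mulrC.
Qed.

Lemma is_derive_coord a k i :
  is_derive a (delta_mx 0 k) (fun x : 'rV[K]_n => x 0 i) (i == k)%:R.
Proof.
(* A coordinate is a continuous linear map, hence its own differential. *)
have [f fE] : exists f : {linear 'rV[K]_n -> K}, (fun x : 'rV[K]_n => x 0 i) = f.
  have @f : {linear 'rV[K]_n -> K}.
    by exists (fun N : 'rV[K]_n => N 0 i); do 2![eexists]; do ?[constructor];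
      rewrite ?mxE// => ? *; rewrite ?mxE//; move=> ?; rewrite !mxE.
  by exists f.
have fc : continuous f by rewrite -fE; apply: coord_continuous.
have fd : differentiable f a := linear_differentiable a fc.
rewrite fE; apply: DeriveDef; first exact: diff_derivable.
by rewrite deriveE // diff_lin // -fE mxE eqxx eq_sym.
Qed.

(** Serves both g_a, with u i = X^i, and its derivative in x, with u i = (X^i)'. The two terms come
    from the motion of the point and from the k-th coefficient. *)
Lemma is_derive_affine a k b (db : K) (q : {poly K}) (u : 'I_n -> {poly K}) :
  is_derive a (delta_mx 0 k) b db ->
  is_derive a (delta_mx 0 k) (fun x => (q + \sum_i x 0 i *: u i).[b x])
    ((q + \sum_i a 0 i *: u i)^`().[b a] * db + (u k).[b a]).
Proof.
move=> bP.
have sP : is_derive a (delta_mx 0 k) (\sum_i (fun x : 'rV[K]_n => x 0 i * (u i).[b x]))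
   (\sum_i (a 0 i * ((u i)^`().[b a] * db) + (u i).[b a] * (i == k)%:R)).
  apply: is_derive_sum => i; apply: is_derive_mul; first exact: is_derive_coord.
  exact: is_derive_horner.
apply: is_derive_ext (is_derive_add (is_derive_horner q bP) sP) => [x|].
  rewrite hornerD horner_sum fct_sumE; congr (_ + _).
  by apply: eq_bigr => i _; rewrite hornerZ.
rewrite derivD hornerD mulrDl -addrA; congr (_ + _).
rewrite big_split /= raddf_sum /= horner_sum mulr_suml; congr (_ + _).
  by apply: eq_bigr => i _; rewrite derivZ hornerZ mulrA.
rewrite (bigD1 k) //= eqxx mulr1 big1 ?addr0 // => i /negPf ->.
by rewrite mulr0.
Qed.

End Derivation.

(** * Carathéodory's criterion *)

Section Differentiability.
Variables (K : numFieldType) (V : normedModType K).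

Lemma differentiable_littleo (f : V -> K) x :
  f \o shift x = cst (f x) +o_ (0 : V) id -> differentiable f x.
Proof.
move=> fo.
have zc : continuous (\0 : {linear V -> K}) by move=> ?; apply: cvg_cst.
have fo' : f \o shift x = cst (f x) + (\0 : {linear V -> K}) +o_ (0 : V) id.
  by rewrite [X in cst (f x) + X](_ : _ = 0) ?addr0.
by apply/diff_locallyP; rewrite (diff_unique zc fo').
Qed.

(** Replacing h by its value at x leaves the error g(y) (h(y) - h(x)). This is o(y - x), because g
    is O(y - x) and h is continuous at x. *)
Lemma differentiable_caratheodory (f g h : V -> K) x :
  differentiable g x -> g x = 0 -> {for x, continuous h} ->
  (\forall y \near x, f y = f x + g y * h y) -> differentiable f x.
Proof.
move=> gd g0 hc fE.
pose e y := f y - f x - h x * g y.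
have -> : f = cst (f x) + (h x *: g + e).
  apply: funext => y; rewrite -[RHS]/(f x + (h x * g y + e y)) /e.
  by rewrite [h x * g y + _]addrC subrK subrKC.
apply: differentiableD => //; apply: differentiableD; first exact: differentiableZ.
apply: differentiable_littleo; apply/eqaddoP => eps eps0.
have ex : e x = 0 by rewrite /e g0 subrr mulr0 subrr.
(* Differentiable at x and zero there, g is bounded by a multiple of the increment. *)
have [k k0 gk] : exists2 k, 0 < k & \forall y \near (0 : V), `|g (y + x)| <= k * `|y|.
  have /eqO_exP[k k0 dk] : ('d g x : V -> K) =O_ (0 : V) id by apply: diff_eqO.
  have /eqaddoP/(_ 1 ltr01) go := diff_locally gd.
  exists (k + 1); first by rewrite addr_gt0.
  near=> y.
  rewrite -[g _](subrK ('d g x y)) mulrDl mul1r addrC.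
  apply: le_trans (ler_normD _ _) _; apply: lerD; first by near: y.
  have : `|(g \o shift x - (cst (g x) + 'd g x)) y| <= 1 * `|y| by near: y.
  by rewrite mul1r !fctE /= g0 add0r.
have hk : \forall y \near (0 : V), `|h x - h (y + x)| < eps / k.
  have : \forall y \near x, `|h x - h y| < eps / k.
    exact: (@cvgr_dist_lt _ _ _ _ _ h (h x) hc (eps / k) (divr_gt0 eps0 k0)).
  by rewrite (near_shift 0 x) subr0.
have {}fE : \forall y \near (0 : V), f (y + x) = f x + g (y + x) * h (y + x).
  by move: fE; rewrite (near_shift 0 x) subr0.
near=> y; rewrite !fctE /= ex subr0.
have -> : e (y + x) = g (y + x) * (h (y + x) - h x).
  by rewrite /e (near fE y) //; ring.
rewrite normrM mulrC -[eps](divfK (lt0r_neq0 k0)) -[_ / k * k * _]mulrA.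
apply: ler_pM => //; last by near: y.
by rewrite distrC ltW //; near: y.
Unshelve. all: by end_near. Qed.

End Differentiability.

(** * Holomorphic branches of simple roots *)

Section DifferenceQuotient.
Variable K : comNzRingType.
Implicit Types (f : {poly K}) (x y : K).

(** (f(x) - f(y)) / (x - y) expanded without division, so that it makes sense on the diagonal. The
    bound d keeps the number of terms constant in a family. *)
Definition diffquo d f x y : K :=
  \sum_(i < d) f`_i * \sum_(j < i) x ^+ (i.-1 - j) * y ^+ j.

Lemma diffquoE d f x y : (size f <= d)%N ->
  f.[x] - f.[y] = (x - y) * diffquo d f x y.
Proof.
move=> fd; rewrite !(horner_coef_wide _ fd) -sumrB mulr_sumr.
by apply: eq_bigr => i _; rewrite -mulrBr subrXX mulrCA.
Qed.

Lemma diffquo_diag d f x : (size f <= d)%N -> diffquo d f x x = f^`().[x].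
Proof.
move=> fd; rewrite -[in RHS](coefK f) poly_def raddf_sum horner_sum /=.
rewrite /diffquo (big_ord_widen d (fun i => (f`_i *: 'X^i)^`().[x])) //.
rewrite [RHS]big_mkcond; apply: eq_bigr => i _ /=.
case: ltnP => [_|fi]; last by rewrite nth_default // mul0r.
rewrite derivZ derivXn hornerZ hornerMn hornerXn; congr (_ * _).
rewrite (eq_bigr (fun=> x ^+ i.-1)) ?sumr_const ?card_ord // => j _.
by rewrite -exprD subnK // -ltnS (ltn_predK (ltn_ord j)).
Qed.

End DifferenceQuotient.

Lemma polyfun_diffquo (K : closedFieldType) m d (F : (nat -> K) -> {poly K}) p q :
  polyfam m F -> polyfun m p -> polyfun m q ->
  polyfun m (fun v => diffquo d (F v) (p v) (q v)).
Proof.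
move=> [_ FP] pP qP; apply: polyfun_sum => i; apply: polyfunM; first exact: FP.
by apply: polyfun_sum => j; apply: polyfunM; apply: polyfun_exp.
Qed.

(** * Roots of a differentiable family of polynomials *)

Section Branch.
Variable K : numFieldType.

Section Limits.
Variables (T : Type) (G : set_system T).
Context {FG : Filter G}.

Lemma cvg_expn (u : T -> K) (l : K) k :
  u t @[t --> G] --> l -> u t ^+ k @[t --> G] --> l ^+ k.
Proof.
move=> ul; elim: k => [|k IHk]; first exact: cvg_cst.
by rewrite exprS; under eq_fun do rewrite exprS; apply: cvgM.
Qed.

Lemma cvg_sumr (I : Type) (s : seq I) (u : I -> T -> K) (l : I -> K) :
  (forall i, u i t @[t --> G] --> l i) ->
  \sum_(i <- s) u i t @[t --> G] --> \sum_(i <- s) l i.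
Proof. by move=> ul; apply: cvg_big => // x; apply: add_continuous. Qed.

Lemma cvg_diffquo d (f : T -> {poly K}) (fl : {poly K}) (x y : T -> K) (xl yl : K) :
  (forall i, (f t)`_i @[t --> G] --> fl`_i) ->
  x t @[t --> G] --> xl -> y t @[t --> G] --> yl ->
  diffquo d (f t) (x t) (y t) @[t --> G] --> diffquo d fl xl yl.
Proof.
move=> ffl xxl yyl; apply: cvg_sumr => i; apply: cvgM => //.
by apply: cvg_sumr => j; apply: cvgM; apply: cvg_expn.
Qed.

Lemma cvg_horner d (f : T -> {poly K}) (fl : {poly K}) (x : T -> K) (xl : K) :
  (forall t, (size (f t) <= d)%N) -> (size fl <= d)%N ->
  (forall i, (f t)`_i @[t --> G] --> fl`_i) ->
  x t @[t --> G] --> xl -> (f t).[x t] @[t --> G] --> fl.[xl].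
Proof.
move=> fd fld ffl xxl; rewrite (horner_coef_wide _ fld).
under eq_fun do rewrite (horner_coef_wide _ (fd _)).
by apply: cvg_sumr => i; apply: cvgM => //; apply: cvg_expn.
Qed.

End Limits.

Variables (V : normedModType K) (F : V -> {poly K}) (d : nat).
Hypothesis F_split : forall a, exists rs, F a = \prod_(z <- rs) ('X - z%:P).
Hypothesis size_F : forall a, size (F a) = d.+1.
Hypothesis coef_differentiable : forall i a, differentiable (fun x => (F x)`_i) a.

Let coef_cvg i a : (F x)`_i @[x --> a] --> (F a)`_i.
Proof. exact: (differentiable_continuous (coef_differentiable i a)). Qed.

(* The product of the distances from y to the roots of F x is |F x (y)|, which
   tends to 0. *)
Lemma root_nearby a y (e : K) : root (F a) y -> 0 < e ->
  \forall x \near a, exists2 z, root (F x) z & `|y - z| < e.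
Proof.
move=> Fy e0.
have : (F x).[y] @[x --> a] --> (F a).[y].
  apply: (@cvg_horner _ _ _ d.+1 F (F a) (fun=> y)) => [t||i|]; rewrite ?size_F //.
    exact: coef_cvg.
  exact: cvg_cst.
rewrite (rootP Fy) => /cvgr_dist_lt/(_ (e ^+ d) (exprn_gt0 d e0)).
apply: filterS => x; rewrite sub0r normrN => small.
apply: contrapT => far.
have [rs Fx] := F_split x.
have sz : size rs = d.
  by apply: succn_inj; rewrite -(size_F x) Fx size_prod_XsubC.
have rs_far z : z \in rs -> e <= `|y - z|.
  move=> zrs; rewrite real_leNgt ?normr_real ?gtr0_real //; apply/negP => near.
  by apply: far; exists z => //; rewrite Fx root_prod_XsubC.
suff : e ^+ size rs <= `|(F x).[y]|.
  by rewrite sz real_leNgt ?small // realX ?gtr0_real.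
rewrite Fx horner_prod normr_prod; elim: rs rs_far {Fx sz} => [|z rs IHrs] zrs_far.
  by rewrite big_nil expr0.
rewrite big_cons exprS hornerXsubC; apply: ler_pM; rewrite ?exprn_ge0 ?(ltW e0) //.
  exact/zrs_far/mem_head.
by apply: IHrs => t trs; apply: zrs_far; rewrite in_cons trs orbT.
Qed.

(** The difference quotient is continuous in (a, x, y) and equals F'(beta) at (a0, beta, beta).
    Where it is nonzero, two roots of [F a] must coincide. *)
Lemma simple_root_isolated a0 beta :
  (F a0)^`().[beta] != 0 ->
  exists2 e : K, 0 < e & \forall a \near a0, forall x y,
    `|beta - x| < e -> `|beta - y| < e -> diffquo d.+1 (F a) x y != 0.
Proof.
move=> F'0.
have : diffquo d.+1 (F t.1) t.2.1 t.2.2 @[t --> (a0, (beta, beta))] -->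
       diffquo d.+1 (F a0) beta beta.
  apply: cvg_diffquo => [i||].
  - by apply: (cvg_comp fst (fun x => (F x)`_i) cvg_fst); apply: coef_cvg.
  - exact: (cvg_comp (@snd V (K * K)%type) fst cvg_snd cvg_fst).
  - exact: (cvg_comp (@snd V (K * K)%type) snd cvg_snd cvg_snd).
rewrite diffquo_diag ?size_F // => /cvgr_neq0/(_ F'0).
move=> [[A B] [/= nA [[B1 B2] [/= nB1 nB2] B12]] AB].
have /nbhs_ballP[e e0 eB] : nbhs beta (B1 `&` B2) by apply: filterI.
exists e => //; apply: filterS nA => a Aa x y xe ye.
apply: (AB (a, (x, y))); split=> //=; apply: B12; split=> /=.
  by have [] := eB x xe.
by have [] := eB y ye.
Qed.

(** An implicit function theorem for roots: [root_nearby] gives a root in a fixed ball about beta,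
    [simple_root_isolated] its uniqueness. Existence in smaller balls then gives continuity, and
    Carathéodory's criterion differentiability. *)
Lemma simple_root_branch a0 beta :
  root (F a0) beta -> (F a0)^`().[beta] != 0 ->
  exists b : V -> K, b a0 = beta /\
    \forall a \near a0, differentiable b a /\ root (F a) (b a).
Proof.
move=> Fbeta F'0; have [e e0 unique] := simple_root_isolated F'0.
have exist := root_nearby Fbeta e0.
pose P a z := root (F a) z /\ `|beta - z| < e.
(* The default beta is taken only where [F a] has no root in the ball, which does not happen near
   a0. *)
pose b a := xget beta (P a).
have F_unique a x y : (forall x y, `|beta - x| < e -> `|beta - y| < e ->
    diffquo d.+1 (F a) x y != 0) -> P a x -> P a y -> x = y.
  move=> nz [/rootP Fx xe] [/rootP Fy ye]; apply/eqP; rewrite -subr_eq0.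
  have := @diffquoE _ d.+1 (F a) x y _; rewrite size_F Fx Fy subrr => /(_ (leqnn _)).
  by move=> /esym/eqP; rewrite mulf_eq0 (negPf (nz x y xe ye)) orbF.
have bP a z : P a z -> P a (b a) by move=> Pz; apply: (@xgetPex _ beta (P a)); exists z.
exists b; split.
  apply: (F_unique a0) => //; first exact: (nbhs_singleton unique).
    by apply: (bP a0 beta); split; rewrite ?subrr ?normr0.
  by split; rewrite ?subrr ?normr0.
near=> a1.
have [z Fz ze] : exists2 z, root (F a1) z & `|beta - z| < e by near: a1.
have [Fb1 b1e] : P a1 (b a1) by apply: (bP a1 z).
split => //.
(* What holds near a0 also holds near each a1 close to a0; this gives differentiability on a whole
   neighbourhood. *)
have uni1 : \forall a \near a1, forall x y, `|beta - x| < e -> `|beta - y| < e ->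
    diffquo d.+1 (F a) x y != 0 by near: a1; apply: near_join.
have ex1 : \forall a \near a1, exists2 z, root (F a) z & `|beta - z| < e.
  by near: a1; apply: near_join.
have bc : b x @[x --> a1] --> b a1.
  apply/cvgrPdist_lt => eps eps0.
  have be0 : 0 < e - `|beta - b a1| by rewrite subr_gt0.
  (* A root this close to [b a1] stays within e of beta, hence is [b a]. As K is only partially
     ordered, the minimum calls for comparability. *)
  pose m := Num.min eps (e - `|beta - b a1|).
  have ltm t : (t < m) = (t < eps) && (t < e - `|beta - b a1|).
    by rewrite comparable_lt_min // real_comparable ?gtr0_real.
  have := root_nearby Fb1 (_ : 0 < m); rewrite ltm eps0 be0 => /(_ isT) nearby.
  near=> a.
  have [y Fy] : exists2 y, root (F a) y & `|b a1 - y| < m by near: a.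
  rewrite ltm => /andP[y_eps y_e].
  have Pay : P a y.
    split=> //; rewrite -(subrK (b a1) beta) -addrA.
    by apply: le_lt_trans (ler_normD _ _) _; rewrite -ltrBrDl.
  suff -> : b a = y by [].
  apply: (F_unique a) => //; last exact: bP Pay.
  by near: a.
(* Since [F a] vanishes at [b a], the difference b a - b a1 is minus (F a).[b a1] divided by the
   difference quotient at (b a, b a1). *)
pose g a := - ((F a).[b a1] - (F a1).[b a1]).
pose h a := (diffquo d.+1 (F a) (b a) (b a1))^-1.
apply: (@differentiable_caratheodory _ _ b g h a1).
- have -> : g = - (\sum_(i < d.+1) (b a1 ^+ i *: (fun x => (F x)`_i)) - cst (F a1).[b a1]).
    apply: funext => x; rewrite /g !fctE fct_sumE (@horner_coef_wide _ d.+1) ?size_F //.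
    by congr (- (_ - _)); apply: eq_bigr => i _; rewrite mulrC.
  apply/differentiableN/differentiableB; last exact: differentiable_cst.
  by apply: differentiable_sum => i; apply: differentiableZ.
- by rewrite /g subrr oppr0.
- apply: cvgV; first exact: (nbhs_singleton uni1).
  by apply: cvg_diffquo => [i||]; [exact: coef_cvg|exact: bc|exact: cvg_cst].
near=> a.
have uni_a : forall x y, `|beta - x| < e -> `|beta - y| < e ->
    diffquo d.+1 (F a) x y != 0 by near: a.
have [y Fy ye] : exists2 z, root (F a) z & `|beta - z| < e by near: a.
have [Fb be] : P a (b a) by apply: (bP a y).
have nz := uni_a _ _ be b1e.
have := @diffquoE _ d.+1 (F a) (b a) (b a1) _; rewrite size_F => /(_ (leqnn _)).
rewrite /g /h (rootP Fb) (rootP Fb1) subr0 sub0r => ->.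
by rewrite mulfK // subrKC.
Unshelve. all: by end_near. Qed.

End Branch.

(** * Iteration of polynomials *)

Section Iterates.
Variable R : realType.
Local Notation C := R[i].
Implicit Types (g : {poly C}) (x y : C) (r : nat).

Lemma horner_iter_poly g r x : (iter_poly g r).[x] = iter r (horner g) x.
Proof. by elim: r => [|r IHr]; rewrite ?hornerX //= horner_comp IHr. Qed.

Lemma root_iter_poly g r x :
  root (iter_poly g r - 'X) x = (iter r (horner g) x == x).
Proof. by rewrite /root hornerD hornerN hornerX horner_iter_poly subr_eq0. Qed.

Lemma deriv_iter_polyS g r x : (iter_poly g r.+1)^`().[x] =
  g^`().[iter r (horner g) x] * (iter_poly g r)^`().[x].
Proof. by rewrite /= deriv_comp hornerM horner_comp horner_iter_poly. Qed.

Lemma iter_poly_monic_size g n r : (1 < n)%N -> g \is monic -> size g = n.+1 ->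
  iter_poly g r \is monic /\ size (iter_poly g r) = (n ^ r).+1.
Proof.
move=> n1 gm sg; elim: r => [|r [mr sr]]; first by rewrite monicX size_polyX.
have r0 : (0 < n ^ r)%N by rewrite expn_gt0 (ltn_trans _ n1).
split=> /=.
  by rewrite monicE lead_coef_comp ?sr ?ltnS // (monicP gm) (monicP mr) expr1n mulr1.
have nr : (0 < n ^ r.+1)%N by rewrite expn_gt0 (ltn_trans _ n1).
have := size_comp_poly g (iter_poly g r); rewrite sg sr /= -expnS.
by move: nr; case: (size _) => [|s] /= + E; rewrite -E.
Qed.

Lemma iter_poly_subX g n r : (1 < n)%N -> (0 < r)%N -> g \is monic -> size g = n.+1 ->
  iter_poly g r - 'X \is monic /\ size (iter_poly g r - 'X) = (n ^ r).+1.
Proof.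
move=> n1 r0 gm sg; have [mr sr] := iter_poly_monic_size r n1 gm sg.
have sX : (size (- 'X : {poly C})%R < size (iter_poly g r))%N.
  by rewrite size_polyN size_polyX sr ltnS; apply: leq_ltn_trans r0 (ltn_expl r n1).
split; last by rewrite size_polyDl.
by rewrite monicE lead_coefDl // (monicP mr).
Qed.

Lemma no_multiple_rootP (p : {poly C}) :
  no_multiple_root p <-> forall x, root p x -> p^`().[x] != 0.
Proof.
split=> [pn x px|pn x]; last first.
  apply/negP => /dvdpP[q]; rewrite expr2 mulrA => pE.
  have px : root p x by rewrite pE rootM root_XsubC eqxx orbT.
  have := pn x px; rewrite pE derivM derivXsubC mulr1 hornerD !hornerM.
  by rewrite hornerXsubC subrr !mulr0 addr0 eqxx.
apply/eqP => p'x; have := pn x.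
have /factor_theorem[q pE] := px.
rewrite pE in p'x *.
move: p'x; rewrite derivM derivXsubC mulr1 hornerD hornerM hornerXsubC subrr.
rewrite mulr0 add0r => /rootP/factor_theorem[q' ->].
by rewrite -mulrA -expr2 dvdp_mull.
Qed.

Lemma iter_horner_periodic g r x k : iter r (horner g) x = x ->
  iter (k * r) (horner g) x = x.
Proof. by move=> xr; elim: k => // k IHk; rewrite mulSn iterD IHk. Qed.

Lemma orbit_of_iter g r x k : (0 < r)%N -> iter r (horner g) x = x ->
  orbit_of g (iter k (horner g) x) = orbit_of g x.
Proof.
move=> r0 xr; apply/seteqP; split=> _ [j _ <-].
  by exists (j + k)%N; rewrite ?iterD.
(* [k * r - k] further steps lead from the k-th iterate back to x. *)
exists (j + (k * r - k))%N => //; rewrite -iterD -addnA subnK ?leq_pmulr //.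
by rewrite iterD iter_horner_periodic.
Qed.

Lemma exact_period_inj g r x j k : exact_period g r x -> (j < r)%N -> (k < r)%N ->
  iter j (horner g) x = iter k (horner g) x -> j = k.
Proof.
wlog jk : j k / (j < k)%N => [hw xr jr kr e|[r0 xr xmin] _ kr e].
  by case: (ltngtP j k) => // jk; [exact: hw|apply/esym; exact: hw].
(* The r - k steps from g^k(x) to x also lead from g^j(x) to x, so r - k + j is a return time below
   r. *)
case: (xmin (r - k + j)%N).
  by rewrite addn_gt0 subn_gt0 kr /= -ltn_subRL subKn // ltnW.
by rewrite iterD e -iterD subnK // ltnW.
Qed.

(** An iterate y of x also returns after r steps, so its exact period is at most r; symmetry does
    the rest. *)
Lemma exact_period_orbit_eq g r s x y : exact_period g r x -> exact_period g s y ->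
  orbit_of g x = orbit_of g y -> r = s.
Proof.
wlog suff : r s x y / exact_period g r x -> exact_period g s y ->
    orbit_of g x = orbit_of g y -> (s <= r)%N => [hw xr ys xy|].
  by apply/eqP; rewrite eqn_leq (hw _ _ _ _ xr ys xy) (hw _ _ _ _ ys xr).
move=> [r0 xr _] [_ _ ymin] xy.
have [k _ yE] : orbit_of g x y by rewrite xy; exists 0%N.
rewrite leqNgt; apply/negP => rs; apply: (ymin r); first by rewrite r0.
by rewrite -yE -iterD addnC iterD xr.
Qed.

(* Two roots of a polynomial without multiple roots differ if and only if the
   difference quotient vanishes at them: this turns the open conditions on
   periods and orbits into closed ones. *)
Lemma diffquo_roots_neq d (p : {poly C}) x y : no_multiple_root p ->
  (size p <= d)%N -> root p x -> root p y -> diffquo d p x y = 0 <-> x <> y.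
Proof.
move=> /no_multiple_rootP pn pd px py; split=> [dq0 xy|/eqP xy].
  by move: (pn x px); rewrite -(diffquo_diag _ pd) {2}xy dq0 eqxx.
apply/eqP; have /esym/eqP := diffquoE x y pd.
by rewrite (rootP px) (rootP py) subrr mulf_eq0 subr_eq0 (negPf xy).
Qed.

End Iterates.

(** * Gradients of multipliers *)

Section Gradient.
Variables (R : realType) (n : nat).
Local Notation C := R[i].
Implicit Types (g u : {poly C}) (r : nat) (a : 'rV[C]_n).

(** Links row vectors to the sequences used by [polyfun]; functions in [polyfun n] do not see the
    padding by 0. *)
Definition rowfun a : nat -> C := fun i => if insub i is Some k then a 0 k else 0.
Definition funrow (v : nat -> C) : 'rV[C]_n := \row_i v i.

Lemma rowfunE a (k : 'I_n) : rowfun a k = a 0 k.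
Proof. by rewrite /rowfun valK. Qed.

Lemma rowfunK a : funrow (rowfun a) = a.
Proof. by apply/rowP => k; rewrite mxE rowfunE. Qed.

Lemma funrowK v i : (i < n)%N -> rowfun (funrow v) i = v i.
Proof. by move=> im; rewrite /rowfun insubT mxE. Qed.

Lemma polyfun_differentiable (p : (nat -> C) -> C) a :
  polyfun n p -> differentiable (fun x : 'rV[C]_n => p (rowfun x)) a.
Proof.
elim=> [c|i im|p1 p2 _ d1 _ d2|p1 p2 _ d1 _ d2].
- exact: differentiable_cst.
- rewrite (_ : (fun _ => _) = (fun x : 'rV[C]_n => x 0 (Ordinal im))).
    exact: differentiable_coord.
  by apply: funext => x; rewrite -rowfunE.
- exact: differentiableD d1 d2.
- exact: differentiableM d1 d2.
Qed.

Lemma polyfam_monic_of : polyfam n (fun v => monic_of (funrow v)).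
Proof.
apply: polyfamD; first exact: polyfam_cst.
apply: polyfam_sum => i; apply: (@polyfam_ext _ _ _ (fun v => (v i)%:P * 'X^i)).
  by move=> v; rewrite mxE mul_polyC.
by apply: polyfamM; [apply/polyfamC/polyfunX|apply: polyfam_cst].
Qed.

Lemma polyfam_iter_poly r : polyfam n (fun v => iter_poly (monic_of (funrow v)) r).
Proof.
elim: r => [|r IHr]; first exact: polyfam_cst.
exact: polyfam_comp polyfam_monic_of IHr.
Qed.

Definition perpoly r a : {poly C} := iter_poly (monic_of a) r - 'X.

Lemma polyfam_perpoly r : polyfam n (fun v => perpoly r (funrow v)).
Proof.
apply: polyfamD; first exact: polyfam_iter_poly.
exact/polyfamN/polyfam_cst.
Qed.

Lemma monic_of_monic_size a : monic_of a \is monic /\ size (monic_of a) = n.+1.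
Proof.
have s : (size (\sum_(i < n) a 0 i *: 'X^i)%R < n.+1)%N.
  rewrite ltnS; apply/(leq_trans (size_sum _ _ _))/bigmax_leqP => i _.
  by apply: leq_trans (size_scale_leq _ _) _; rewrite size_polyXn.
by rewrite monicE lead_coefDl ?size_polyDl ?size_polyXn // lead_coefXn.
Qed.

Hypothesis n_gt1 : (1 < n)%N.

Lemma perpoly_monic_size r a : (0 < r)%N ->
  perpoly r a \is monic /\ size (perpoly r a) = (n ^ r).+1.
Proof. by move=> r0; have [] := monic_of_monic_size a; apply: iter_poly_subX. Qed.

(** [xget] returns a genuine branch once one exists. [simple_root_branch] provides it, as f_a is
    monic, splits, and has coefficients polynomial in a. *)
Lemma perpoly_branch r a0 beta : (0 < r)%N -> Zr r a0 ->
  root (perpoly r a0) beta -> is_branch a0 r beta (branch a0 r beta).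
Proof.
move=> r0 /no_multiple_rootP Za0 Fbeta.
suff [b bP] : exists b, is_branch a0 r beta b by apply: (xgetPex _ (ex_intro _ b bP)).
have split_perpoly a : exists rs, perpoly r a = \prod_(z <- rs) ('X - z%:P).
  have [rs rsE] := closed_field_poly_normal (perpoly r a).
  have [Fm _] := perpoly_monic_size a r0.
  by exists rs; rewrite rsE (monicP Fm) scale1r.
have coef_diff i a : differentiable (fun x : 'rV[C]_n => (perpoly r x)`_i) a.
  have [_ /(_ i)/(polyfun_differentiable a)] := polyfam_perpoly r.
  by under eq_fun do rewrite rowfunK.
have [b [b0 bnear]] := simple_root_branch split_perpoly
  (fun a => proj2 (perpoly_monic_size a r0)) coef_diff Fbeta (Za0 beta Fbeta).
exists b; split=> //; apply: filterS bnear => a [bd].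
by rewrite root_iter_poly -horner_iter_poly => /eqP.
Qed.

(* First order variations of iter j g x and of (iter_poly g j)^`().[x] when g
   varies at speed e *: u and x at speed d. *)
Fixpoint diter g u (d e : C) x j : C :=
  if j is j'.+1 then
    let y := iter j' (horner g) x in g^`().[y] * diter g u d e x j' + e * u.[y]
  else d.

Fixpoint dmult g u (d e : C) x j : C :=
  if j is j'.+1 then
    let y := iter j' (horner g) x in
    g^`().[y] * dmult g u d e x j' +
    (g^`(2).[y] * diter g u d e x j' + e * u^`().[y]) * (iter_poly g j')^`().[x]
  else 0.

Lemma diterZ g u c d e x j : diter g u (c * d) (c * e) x j = c * diter g u d e x j.
Proof. by elim: j => //= j ->; ring. Qed.

Lemma dmultZ g u c d e x j : dmult g u (c * d) (c * e) x j = c * dmult g u d e x j.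
Proof. by elim: j => /= [|j ->]; rewrite ?mulr0 // diterZ; ring. Qed.

(** The initial speed is transported by the derivative of the iterate; the variation of g adds a
    term independent of d. *)
Lemma diter_affine g u d e x j :
  diter g u d e x j = (iter_poly g j)^`().[x] * d + diter g u 0 e x j.
Proof.
elim: j => [|j IHj]; first by rewrite /= derivX hornerC mul1r addr0.
by rewrite deriv_iter_polyS /= IHj; ring.
Qed.

Lemma polyfun_iter m p j : polyfun (n + m) p ->
  polyfun (n + m) (fun v => iter j (horner (monic_of (funrow v))) (p v)).
Proof.
move=> pP; elim: j => //= j IHj; apply: polyfam_horner => //.
exact: polyfam_leq (leq_addr _ _) polyfam_monic_of.
Qed.

Lemma polyfun_diter m u d e p j : polyfun (n + m) d -> polyfun (n + m) e ->
  polyfun (n + m) p ->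
  polyfun (n + m) (fun v => diter (monic_of (funrow v)) u (d v) (e v) (p v) j).
Proof.
move=> dP eP pP; have gP := polyfam_leq (leq_addr m n) polyfam_monic_of.
elim: j => //= j IHj; have yP := polyfun_iter j pP.
apply: polyfunD; apply: polyfunM => //; apply: polyfam_horner => //.
  exact: polyfam_deriv.
exact: polyfam_cst.
Qed.

Lemma polyfun_dmult m u d e p j : polyfun (n + m) d -> polyfun (n + m) e ->
  polyfun (n + m) p ->
  polyfun (n + m) (fun v => dmult (monic_of (funrow v)) u (d v) (e v) (p v) j).
Proof.
move=> dP eP pP; have gP := polyfam_leq (leq_addr m n) polyfam_monic_of.
have g'P := polyfam_deriv gP; have g''P := polyfam_deriv g'P.
elim: j => [|j IHj] /=; first exact: polyfunC.
have yP := polyfun_iter j pP.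
apply: polyfunD; apply: polyfunM => //; first exact: polyfam_horner.
  apply: polyfunD; apply: polyfunM => //; first exact: polyfam_horner.
    exact: polyfun_diter.
  by apply: polyfam_horner => //; apply: polyfam_cst.
apply: polyfam_horner => //; apply: polyfam_deriv.
exact: polyfam_leq (leq_addr m n) (polyfam_iter_poly j).
Qed.

Lemma is_derive_horner_monic_of a k (b : 'rV[C]_n -> C) (db : C) :
  is_derive a (delta_mx 0 k) b db ->
  is_derive a (delta_mx 0 k) (fun x => (monic_of x).[b x])
    ((monic_of a)^`().[b a] * db + ('X^k).[b a]).
Proof. exact: is_derive_affine. Qed.

Lemma is_derive_horner_deriv_monic_of a k (b : 'rV[C]_n -> C) (db : C) :
  is_derive a (delta_mx 0 k) b db ->
  is_derive a (delta_mx 0 k) (fun x => (monic_of x)^`().[b x])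
    ((monic_of a)^`(2).[b a] * db + ('X^k)^`().[b a]).
Proof.
move=> bP.
have monicE (x : 'rV[C]_n) :
    (monic_of x)^`() = ('X^n)^`() + \sum_i x 0 i *: ('X^i)^`().
  rewrite /monic_of derivD raddf_sum; congr (_ + _).
  by apply: eq_bigr => i _; apply: derivZ.
rewrite derivSn derivn1 monicE; under [X in is_derive _ _ X]eq_fun do rewrite monicE.
exact: is_derive_affine.
Qed.

Section AlongBranch.
Variables (a : 'rV[C]_n) (k : 'I_n) (b : 'rV[C]_n -> C) (db : C).
Hypothesis bP : is_derive a (delta_mx 0 k) b db.

Lemma is_derive_iter j :
  is_derive a (delta_mx 0 k) (fun x => iter j (horner (monic_of x)) (b x))
    (diter (monic_of a) 'X^k db 1 (b a) j).
Proof.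
elim: j => //= j IHj; rewrite mul1r.
exact: (is_derive_horner_monic_of IHj).
Qed.

Lemma is_derive_mult j :
  is_derive a (delta_mx 0 k) (fun x => (iter_poly (monic_of x) j)^`().[b x])
    (dmult (monic_of a) 'X^k db 1 (b a) j).
Proof.
elim: j => [|j IHj].
  apply: is_derive_ext (is_derive_cst (1 : C) a (delta_mx 0 k)) => // x.
  by rewrite /= derivX hornerC.
apply: is_derive_ext (is_derive_mul (is_derive_horner_deriv_monic_of (is_derive_iter j)) IHj).
  by move=> x; rewrite deriv_iter_polyS.
by rewrite /= mul1r; congr (_ + _); rewrite mulrC.
Qed.

End AlongBranch.

(** Here d is the derivative of the branch b. Differentiating g_a^r(b(a)) = b(a), an identity valid
    near a, shows that the speed after r steps is again d. *)
Lemma gradMultE r a beta (k : 'I_n) : (0 < r)%N -> Zr r a ->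
  root (perpoly r a) beta ->
  exists d, diter (monic_of a) 'X^k d 1 beta r = d /\
            gradMult a r beta 0 k = dmult (monic_of a) 'X^k d 1 beta r.
Proof.
move=> r0 Za Fbeta; have [ba bnear] := perpoly_branch r0 Za Fbeta.
have [bd _] := nbhs_singleton bnear.
set b := branch a r beta in ba bnear bd *.
have bP : is_derive a (delta_mx 0 k) b ('D_(delta_mx 0 k) b a).
  exact/derivableP/diff_derivable.
exists ('D_(delta_mx 0 k) b a); rewrite -{1 3}ba; split.
  have [_ <-] := is_derive_iter bP r.
  apply: near_eq_derive; apply: filterS bnear => x [_ bx].
  by rewrite -[RHS]bx horner_iter_poly.
by rewrite mxE; have [_ <-] := is_derive_mult bP r.
Qed.

(* The factor e clears the denominator in d = diter g 'X^k 0 1 beta r / e, the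
   derivative of the branch. *)
Lemma scaled_gradMultE r a beta (k : 'I_n) (g := monic_of a)
  (e := 1 - (iter_poly g r)^`().[beta]) : (0 < r)%N -> Zr r a ->
  root (perpoly r a) beta ->
  e != 0 /\ e * gradMult a r beta 0 k =
            dmult g 'X^k (diter g 'X^k 0 1 beta r) e beta r.
Proof.
move=> r0 Za Fbeta.
have e0 : e != 0.
  have /no_multiple_rootP/(_ beta Fbeta) := Za.
  by rewrite derivB derivX hornerD hornerN hornerC -oppr_eq0 opprB.
have [d [dE ->]] := gradMultE k r0 Za Fbeta; split=> //.
rewrite -dmultZ mulr1; congr (dmult _ _ _ _ _ _).
rewrite diter_affine in dE.
by rewrite /e mulrBl mul1r -{1}dE addrAC subrr add0r.
Qed.

End Gradient.

(** * The power map *)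

Section PowerMap.
Variables (R : realType) (n : nat).
Local Notation C := R[i].
Local Notation g := ('X^n : {poly C}).
Hypothesis n_gt2 : (2 < n)%N.
Implicit Types (x d : C) (r j : nat) (h : {poly C}).

Let n_gt1 : (1 < n)%N. Proof. exact: ltn_trans n_gt2. Qed.
Let n_gt0 : (0 < n)%N. Proof. exact: ltn_trans n_gt2. Qed.
Let n_neq0 : n%:R != 0 :> C. Proof. by rewrite pnatr_eq0 -lt0n. Qed.

Lemma monic_of0 : monic_of (0 : 'rV[C]_n) = g.
Proof. by rewrite /monic_of big1 ?addr0 // => i _; rewrite mxE scale0r. Qed.

Lemma iter_horner_Xn x j : iter j (horner g) x = x ^+ (n ^ j).
Proof. by elim: j => //= j ->; rewrite hornerXn -exprM expnSr. Qed.

Lemma iter_horner_Xn_neq0 x j : x != 0 -> iter j (horner g) x != 0.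
Proof. by move=> x0; rewrite iter_horner_Xn expf_neq0. Qed.

Lemma iter_poly_Xn r : iter_poly g r = 'X^(n ^ r).
Proof. by elim: r => //= r ->; rewrite comp_Xn_poly -exprM expnSr. Qed.

(** With N = n^r, a root has x = 0 or x^(N-1) = 1, and N x^(N-1) - 1 is then -1 or N - 1. *)
Lemma Zr_Xn r : (0 < r)%N -> Zr r (0 : 'rV[C]_n).
Proof.
move=> r0; apply/no_multiple_rootP => x; rewrite monic_of0 root_iter_poly.
rewrite iter_horner_Xn iter_poly_Xn derivB derivX derivXn hornerD hornerN hornerC.
rewrite hornerMn hornerXn subr_eq0.
have N_gt1 : (1 < n ^ r)%N by apply: leq_ltn_trans r0 (ltn_expl r n_gt1).
move=> /eqP xN; have : x * (x ^+ (n ^ r).-1 - 1) = 0.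
  by rewrite mulrBr mulr1 -exprS (ltn_predK N_gt1) xN subrr.
move=> /eqP; rewrite mulf_eq0 => /orP[/eqP->|].
  by rewrite expr0n -subn1 subn_eq0 leqNgt N_gt1 mul0rn eq_sym oner_eq0.
by rewrite subr_eq0 => /eqP->; rewrite pnatr_eq1 gtn_eqF.
Qed.

(** The factor z restores the exponent lost by differentiation, so that k = 0 needs no separate
    formula. *)
Lemma mulr_horner_derivXn k (z : C) : ('X^k)^`().[z] * z = k%:R * z ^+ k.
Proof.
rewrite derivXn hornerMn hornerXn mulr_natl mulrnAl -exprSr.
by case: k => // k; rewrite mulr0n.
Qed.

(** A logarithmic derivative along the cycle. The relative variations t of the orbit points satisfy
    t_(j+1) = n t_j + s_j, and summing over the cycle eliminates them from the relative variation of
    the multiplier. *)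
Lemma dmult_Xn k x d r : x != 0 -> iter r (horner g) x = x ->
  diter g 'X^k d 1 x r = d ->
  dmult g 'X^k d 1 x r = (iter_poly g r)^`().[x] * ((k%:R - n%:R) / n%:R) *
    \sum_(j < r) (iter j (horner g) x) ^+ k / (iter j (horner g) x) ^+ n.
Proof.
move=> x0 xr dr.
pose y j := iter j (horner g) x; pose s j := y j ^+ k / y j ^+ n.
pose t j := diter g 'X^k d 1 x j / y j.
have y0 j : y j != 0 by apply: iter_horner_Xn_neq0.
have g'E z : g^`().[z] = n%:R * z ^+ n.-1 by rewrite derivXn hornerMn hornerXn mulr_natl.
have yn j : y j ^+ n = y j * y j ^+ n.-1 by rewrite -exprS prednK.
have tS j : t j.+1 = n%:R * t j + s j.
  rewrite /t /= g'E hornerXn mul1r -/(y j) /s hornerXn yn.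
  by have yn0 := expf_neq0 n.-1 (y0 j); field; rewrite yn0 y0.
(* Each summand is the relative variation of g'(y_i) = n y_i^(n-1): the first term comes from the
   coefficient, the second from the motion of y_i. *)
have dmultE j : dmult g 'X^k d 1 x j = (iter_poly g j)^`().[x] *
    \sum_(i < j) (k%:R / n%:R * s i + (n%:R - 1) * t i).
  elim: j => [|j IHj]; first by rewrite big_ord0 mulr0.
  rewrite big_ord_recr deriv_iter_polyS /= IHj -/(y j) mul1r.
  set A := (X in (X + _) * _); set B := k%:R / n%:R * s j + (n%:R - 1) * t j.
  suff -> : A + ('X^k)^`().[y j] = g^`().[y j] * B by ring.
  apply: (mulIf (y0 j)); rewrite mulrDl mulr_horner_derivXn.
  rewrite [RHS]mulrAC mulr_horner_derivXn /A /B /t /s [X in X + _]mulrAC.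
  have -> : g^`(2).[y j] * y j = (n%:R - 1) * (n%:R * y j ^+ n.-1).
    rewrite derivSn derivn1 derivXn derivMn hornerMn mulrnAl mulr_horner_derivXn.
    by rewrite -mulr_natl -subn1 natrB //; ring.
  by rewrite yn; have yn0 := expf_neq0 n.-1 (y0 j); field; rewrite yn0 y0 n_neq0.
rewrite dmultE -mulrA; congr (_ * _); rewrite big_split /= -!mulr_sumr.
(* Both the point and its variation return after r steps, so t agrees at 0 and r. *)
have t_cycle : \sum_(j < r) t j.+1 = \sum_(j < r) t j.
  have [->|r0] := posnP r; first by rewrite !big_ord0.
  rewrite -[in LHS](prednK r0) -[in RHS](prednK r0) big_ord_recr big_ord_recl /=.
  by rewrite (prednK r0) addrC {1 2}/t dr /y xr.
have {}t_cycle : n%:R * \sum_(j < r) t j + \sum_(j < r) s j = \sum_(j < r) t j.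
  by rewrite -[RHS]t_cycle mulr_sumr -big_split; apply: eq_bigr => j _; rewrite tS.
have -> : (n%:R - 1) * \sum_(j < r) t j = - \sum_(j < r) s j.
  apply/eqP; rewrite mulrBl mul1r -subr_eq0 opprK addrAC t_cycle subrr //.
by rewrite /s; field.
Qed.

Lemma gradMult_Xn_neq0 r x (k : 'I_n) : (0 < r)%N -> x != 0 ->
  iter r (horner g) x = x ->
  gradMult (0 : 'rV[C]_n) r x 0 k =
    (iter_poly g r)^`().[x] * ((k%:R - n%:R) / n%:R) *
    \sum_(j < r) (iter j (horner g) x) ^+ k / (iter j (horner g) x) ^+ n.
Proof.
move=> r0 x0 xr.
have [|d [dE ->]] := gradMultE n_gt1 k r0 (Zr_Xn r0) (_ : root (perpoly r 0) x).
  by rewrite root_iter_poly monic_of0 xr.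
by rewrite monic_of0 in dE *; apply: dmult_Xn.
Qed.

(** For n > 2 both g' and g'' vanish at 0, so the motion of the fixed point has no effect and only
    the variation of g' at 0 remains. *)
Lemma gradMult_Xn_0 (k : 'I_n) :
  gradMult (0 : 'rV[C]_n) 1 0 0 k = ('X^k)^`().[0].
Proof.
have [|d [_ ->]] := gradMultE n_gt1 k (ltn0Sn 0) (Zr_Xn (ltn0Sn 0)) (_ : root (perpoly 1 0) 0).
  by rewrite root_iter_poly monic_of0 /= hornerXn expr0n gtn_eqF.
rewrite monic_of0 /= mulr0 add0r mul1r derivX hornerC mulr1.
rewrite [('X^n)^`()]derivXn derivMn derivXn !hornerMn hornerXn expr0n.
by rewrite -!subn1 -subnDA subn_eq0 leqNgt n_gt2 !mul0rn mul0r add0r.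
Qed.

Lemma iter_poly_Xn_deriv_neq0 r x : x != 0 -> (iter_poly g r)^`().[x] != 0.
Proof.
move=> x0; rewrite iter_poly_Xn derivXn hornerMn hornerXn -mulr_natr.
by rewrite mulf_neq0 ?expf_neq0 // pnatr_eq0 -lt0n expn_gt0 n_gt0.
Qed.

Lemma exact_period_Xn0 r : exact_period g r (0 : C) -> r = 1%N.
Proof.
move=> [r0 _ r_min]; apply/eqP; rewrite eqn_leq r0 andbT leqNgt; apply/negP => r1.
by apply: (r_min 1%N) => //=; rewrite hornerXn expr0n gtn_eqF.
Qed.

End PowerMap.

(** * Linear independence of the gradients at x^n *)

Section PowerMapIndependence.
Variables (R : realType) (n l : nat) (r : 'I_l -> nat) (beta : 'I_l -> R[i]).
Local Notation C := R[i].
Local Notation g := ('X^n : {poly C}).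
Hypothesis n_gt2 : (2 < n)%N.
Hypothesis sum_r : (\sum_(i < l) r i <= n)%N.
Hypothesis sum_r1 : (exists j, r j = 1%N) -> (\sum_(i < l) r i < n)%N.
Hypothesis betaP : forall i, exact_period g (r i) (beta i).
Hypothesis beta_orbits :
  forall i j, i != j -> orbit_of g (beta i) <> orbit_of g (beta j).

Let T : finType := {i : 'I_l & 'I_(r i)}%type.
Let pt (p : T) : C := iter (tagged p) (horner g) (beta (tag p)).

Let r_gt0 i : (0 < r i)%N. Proof. by have [] := betaP i. Qed.

Let p0 i : T := Tagged (fun i => 'I_(r i)) (Ordinal (r_gt0 i)).

(** Equal points lie on one orbit, which determines i; within it the exact period determines j. *)
Lemma orbit_points_inj : injective pt.
Proof.
move=> [i j] [i' j'] e0.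
have {e0} e : iter j (horner g) (beta i) = iter j' (horner g) (beta i') := e0.
have ii' : i = i'.
  apply/eqP; apply: contra_notT (@beta_orbits i i') _.
  have [r0 bi _] := betaP i; have [r0' bi' _] := betaP i'.
  by rewrite -(orbit_of_iter j r0 bi) -(orbit_of_iter j' r0' bi') e.
case: _ / ii' in j' e *; congr (existT _ _ _); apply/val_inj.
exact: (exact_period_inj (betaP i)) e.
Qed.

Lemma card_orbit_points : #|T| = (\sum_(i < l) r i)%N.
Proof.
rewrite card_tagged sumnE big_map big_enum /=.
by apply: eq_bigr => i _; rewrite card_ord.
Qed.

(* In degree < n this is, up to a factor depending only on the degree, the
   pairing of h with the gradient of the i-th multiplier at x^n. *)
Definition grad_functional i (h : {poly C}) : C :=
  if beta i == 0 then h^`().[0] * (n%:R / (1 - n%:R)) else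
  (iter_poly g (r i))^`().[beta i] *
    \sum_(j < r i) h.[iter j (horner g) (beta i)] / iter j (horner g) (beta i) ^+ n.

Let n_neq0 : n%:R != 0 :> C. Proof. by rewrite pnatr_eq0 -lt0n (ltn_trans _ n_gt2). Qed.

Lemma gradMult_functional i (k : 'I_n) :
  gradMult (0 : 'rV[C]_n) (r i) (beta i) 0 k =
  (k%:R - n%:R) / n%:R * grad_functional i 'X^k.
Proof.
rewrite /grad_functional; have [bi0|bi0] := eqVneq (beta i) 0.
  have r1 : r i = 1%N by have := betaP i; rewrite bi0 => /(exact_period_Xn0 n_gt2).
  rewrite bi0 r1 gradMult_Xn_0 // derivXn hornerMn hornerXn.
  have n1 : 1 - n%:R != 0 :> C by rewrite subr_eq0 eq_sym pnatr_eq1 gtn_eqF ?(ltn_trans _ n_gt2).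
  (* At k = 1 the factor n / (1 - n) of [grad_functional] cancels (k - n) / n; for other k both
     sides vanish. *)
  case: (k : nat) => [|[|k']]; first by rewrite !mulr0n mul0r mulr0.
    by rewrite !expr0 !mulr1n mul1r; field; rewrite n1 n_neq0.
  by rewrite expr0n /= !mul0rn mul0r mulr0.
have [r0 br _] := betaP i; rewrite gradMult_Xn_neq0 //.
rewrite [RHS]mulrCA [RHS]mulrA; congr (_ * _); apply: eq_bigr => j _.
by rewrite hornerXn.
Qed.

Lemma grad_functional_coef i (h : {poly C}) : (size h <= n)%N ->
  grad_functional i h = \sum_(k < n) h`_k * grad_functional i 'X^k.
Proof.
move=> hn; have hE : h = \sum_(k < n) h`_k *: 'X^k.
  rewrite -poly_def; apply/polyP => k; rewrite coef_poly.
  by case: ltnP => // nk; rewrite nth_default // (leq_trans hn).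
rewrite /grad_functional; case: eqP => _.
  rewrite {1}hE raddf_sum horner_sum mulr_suml; apply: eq_bigr => k _.
  by rewrite /= derivZ hornerZ mulrA.
under [RHS]eq_bigr do rewrite mulrCA mulr_sumr.
rewrite -mulr_sumr exchange_big /=; congr (_ * _); apply: eq_bigr => j _.
rewrite {1}hE horner_sum mulr_suml; apply: eq_bigr => k _.
by rewrite hornerZ mulrA.
Qed.

(* When some beta i is 0, its functional is h'(0) up to a factor, and the extra
   factor 'X gives h a double zero at 0 unless i = i0; the degree bound allows
   it by sum_r1. *)
Lemma separating_polynomial i0 : exists h : {poly C}, [/\ (size h <= n)%N,
  grad_functional i0 h != 0 & forall i, i != i0 -> grad_functional i h = 0].
Proof.
(* All orbit points except [beta i0], so that q vanishes at every orbit point but this one. *)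
pose s := enum (predC1 (p0 i0)).
pose q := \prod_(p <- s) ('X - (pt p)%:P).
(* A boolean read as 0 or 1: the factor X is added exactly when the size bound leaves room for
   it. *)
pose e : nat := (\sum_(i < l) r i < n)%N.
pose h := 'X^e * q.
have qpt p : root q (pt p) = (p != p0 i0).
  rewrite /q -(big_map pt xpredT (fun z => 'X - z%:P)) root_prod_XsubC.
  by rewrite mem_map ?mem_enum //; apply: orbit_points_inj.
have hpt p : p != p0 i0 -> h.[pt p] = 0.
  by rewrite -qpt => /rootP qp; rewrite /h hornerM qp mulr0.
(* One factor fewer than there are points, so the size, one more than the degree, is their
   number. *)
have size_q : size q = (\sum_(i < l) r i)%N.
  rewrite size_prod_XsubC -card_orbit_points -cardE cardC1 prednK //.
  by apply/card_gt0P; exists (p0 i0).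
have h'0 i : beta i = 0 -> h^`().[0] = q.[0].
  move=> bi0; have r1 : r i = 1%N by have := betaP i; rewrite bi0 => /(exact_period_Xn0 n_gt2).
  have -> : h = 'X * q by rewrite /h /e sum_r1 //; exists i.
  by rewrite derivM derivX mul1r hornerD hornerM hornerX mul0r addr0.
have ptE i : pt (p0 i) = beta i by [].
have qi0 : q.[beta i0] != 0 by rewrite -/(root q _) -ptE qpt eqxx.
have n1 : 1 - n%:R != 0 :> C by rewrite subr_eq0 eq_sym pnatr_eq1 gtn_eqF ?(ltn_trans _ n_gt2).
exists h; split.
- have q0 : q != 0 by rewrite -size_poly_gt0 size_q (bigD1 i0) //= addn_gt0 r_gt0.
  by rewrite /h mulrC size_mulXn // size_q /e; case: ltnP.
- rewrite /grad_functional; have [bi0|bi0] := eqVneq (beta i0) 0.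
    by rewrite (h'0 _ bi0) -{1}bi0 mulf_neq0 ?mulf_neq0 ?invr_eq0.
  apply: mulf_neq0; first exact: iter_poly_Xn_deriv_neq0.
  rewrite (bigD1 (Ordinal (r_gt0 i0))) //= big1 ?addr0 => [|j j0].
    rewrite mulf_neq0 ?invr_eq0 ?expf_neq0 // /h hornerM mulf_neq0 //.
    by rewrite hornerXn expf_neq0.
  rewrite (hpt (Tagged (fun i => 'I_(r i)) j)) ?mul0r //.
  by apply: contraNneq j0 => /eqP; rewrite eq_Tagged.
move=> i ii0; have pi (j : 'I_(r i)) : Tagged (fun i => 'I_(r i)) j != p0 i0.
  by apply: contraNneq ii0 => /(congr1 tag)/= ->.
rewrite /grad_functional; have [bi0|bi0] := eqVneq (beta i) 0.
  have := pi (Ordinal (r_gt0 i)).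
  by rewrite -qpt => /rootP; rewrite ptE (h'0 _ bi0) bi0 => ->; rewrite mul0r.
by rewrite big1 ?mulr0 // => j _; rewrite (hpt _ (pi j)) mul0r.
Qed.

(** Cancelling (k - n) / n, nonzero for k < n, turns a relation v among the rows into a combination
    of the functionals that kills all polynomials of size at most n. A separating polynomial then
    isolates the coefficient at i0. *)
Lemma gradMult_Xn_row_free :
  row_free (\matrix_(i < l) gradMult (0 : 'rV[C]_n) (r i) (beta i)).
Proof.
apply: inj_row_free => v vM; apply/rowP => i0; rewrite mxE.
have [h [hn hi0 hi]] := separating_polynomial i0.
have vk (k : 'I_n) : \sum_i v 0 i * grad_functional i 'X^k = 0.
  have kn : (k%:R - n%:R) / n%:R != 0 :> C.
    by rewrite mulf_neq0 ?invr_eq0 // subr_eq0 eqr_nat ltn_eqF.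
  apply: (mulfI kn); rewrite mulr0 mulr_sumr.
  have /rowP/(_ k) := vM; rewrite !mxE => vMk; rewrite -[RHS]vMk.
  by apply: eq_bigr => i _; rewrite mxE gradMult_functional mulrCA.
have : \sum_i v 0 i * grad_functional i h = 0.
  under eq_bigr do rewrite grad_functional_coef // mulr_sumr.
  rewrite exchange_big big1 // => k _.
  under eq_bigr do rewrite mulrCA.
  by rewrite -mulr_sumr vk mulr0.
rewrite (bigD1 i0) //= big1 ?addr0 => [|i ii0]; last by rewrite hi // mulr0.
by move=> /eqP; rewrite mulf_eq0 (negPf hi0) orbF => /eqP.
Qed.

End PowerMapIndependence.

(** * Zariski openness *)

Section ClosedSets.
Variable K : closedFieldType.

Lemma polyclosed_forall (I : Type) m (W : I -> set (nat -> K)) :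
  (forall i, polyclosed m (W i)) -> polyclosed m [set v | forall i, W i v].
Proof.
move=> Wcl v /existsNP[i nWv]; have [p [pP pW pv]] := Wcl i v nWv.
by exists p; split=> // w /(_ i)/pW.
Qed.

Lemma polyclosedI m (W1 W2 : set (nat -> K)) :
  polyclosed m W1 -> polyclosed m W2 -> polyclosed m (W1 `&` W2).
Proof.
move=> W1cl W2cl v /not_andP[/W1cl|/W2cl] [p [pP pW pv]];
by exists p; split=> // w [] *; apply: pW.
Qed.

Lemma polyclosed_zero m (p : (nat -> K) -> K) :
  polyfun m p -> polyclosed m [set v | p v = 0].
Proof. by move=> pP v /= pv; exists p. Qed.

(** Replaces the maximal minors: each B gives a polynomial equation in the entries of N, and a right
    inverse of N violates one of them. *)
Lemma row_free_det l n (N : 'M[K]_(l, n)) :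
  ~~ row_free N <-> forall B : 'M[K]_(n, l), \det (N *m B) = 0.
Proof.
split=> [Nfree B|Ndet]; last first.
  by apply/negP => /row_freeP[B NB]; have /eqP := Ndet B; rewrite NB det1 oner_eq0.
apply/eqP; apply: contraNT Nfree => NB.
have : row_free (N *m B) by rewrite row_free_unit unitmxE unitfE.
rewrite -!row_leq_rank => /leq_trans; apply; exact: mxrankM_maxl.
Qed.

Lemma row_free_scale_rows l n (N G : 'M[K]_(l, n)) (e : 'I_l -> K) :
  (forall i, e i != 0) -> (forall i (k : 'I_n), N i k = e i * G i k) ->
  row_free N = row_free G.
Proof.
move=> e0 NG; have -> : N = diag_mx (\row_i e i) *m G.
  by apply/matrixP => i k; rewrite mul_diag_mx !mxE NG.
rewrite /row_free eqmxMfull // row_full_unit unitmxE.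
rewrite det_diag unitfE prodf_seq_neq0; apply/allP => i _ /=.
by rewrite mxE.
Qed.

End ClosedSets.

Section Openness.
Variables (R : realType) (n l : nat) (r : 'I_l -> nat).
Local Notation C := R[i].
Hypothesis n_gt1 : (1 < n)%N.
Hypothesis r_gt0 : forall i, (0 < r i)%N.
Implicit Types a : 'rV[C]_n.

(** The defining system consists of all polynomials vanishing on W; separation says that it has no
    further zeros. *)
Lemma zariski_closed_polyclosed (W : set (nat -> C)) :
  polyclosed n W -> zariski_closed [set a : 'rV[C]_n | W (rowfun a)].
Proof.
move=> Wcl; exists [set P | forall a, W (rowfun a) -> mpoly.meval (fun i => a 0 i) P = 0].
apply/seteqP; split=> a /= Wa; first by move=> P; apply.
apply: contrapT => /Wcl[p [pP pW pa]]; have [P PE] := polyfun_mpoly pP.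
have PrE (b : 'rV[C]_n) : mpoly.meval (fun i => b 0 i) P = p (rowfun b).
  by rewrite PE; congr mpoly.meval; apply: funext => i; rewrite rowfunE.
by apply: pa; rewrite -PrE; apply: Wa => b /pW <-.
Qed.

(** The nonvanishing locus of p is a principal open set around a inside U. *)
Definition basic_nbhd (U : set 'rV[C]_n) a (p : (nat -> C) -> C) :=
  [/\ polyfun n p, p (rowfun a) != 0 & forall b, p (rowfun b) != 0 -> U b].

Lemma zariski_open_basic (U : set 'rV[C]_n) a :
  zariski_open U -> U a -> exists p, basic_nbhd U a p.
Proof.
move=> [S SU] Ua; have : ~ (~` U) a by move=> nUa; apply: nUa.
rewrite SU => /existsNP[P /not_implyP[SP /eqP Pa]].
have PrE (b : 'rV[C]_n) : mpoly.meval (fun i => rowfun b i) P = mpoly.meval (fun i => b 0 i) P.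
  by congr mpoly.meval; apply: funext => i; rewrite rowfunE.
exists (fun v => mpoly.meval (fun i : 'I_n => v i) P); split.
- exact: mpoly_polyfun.
- by rewrite PrE.
- move=> b /eqP; rewrite PrE; apply: contra_notP => nUb.
  by have : (~` U) b by []; rewrite SU; apply.
Qed.

Lemma basic_nbhd_common (U1 U2 : set 'rV[C]_n) a1 a2 p1 p2 :
  basic_nbhd U1 a1 p1 -> basic_nbhd U2 a2 p2 -> U1 `&` U2 !=set0.
Proof.
move=> [p1P p1a p1U] [p2P p2a p2U].
have [v [p1v p2v]] := polyfun_common_nonzero p1P p2P p1a p2a.
have vE i : (i < n)%N -> rowfun (funrow n v) i = v i by apply: funrowK.
exists (funrow n v); split.
  by apply: p1U; rewrite (polyfun_eq p1P vE).
by apply: p2U; rewrite (polyfun_eq p2P vE).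
Qed.

Lemma basic_nbhdI (U1 U2 : set 'rV[C]_n) a p1 p2 :
  basic_nbhd U1 a p1 -> basic_nbhd U2 a p2 ->
  basic_nbhd (U1 `&` U2) a (fun v => p1 v * p2 v).
Proof.
move=> [p1P p1a p1U] [p2P p2a p2U]; split; first exact: polyfunM.
  by rewrite mulf_neq0.
by move=> b; rewrite mulf_eq0 negb_or => /andP[/p1U ? /p2U].
Qed.

Lemma perpoly_size_pred j : (0 < j)%N ->
  exists d, forall v : nat -> C, size (perpoly j (funrow n v)) = d.+2.
Proof.
move=> j0; exists (n ^ j).-1 => v; have [_ ->] := perpoly_monic_size n_gt1 (funrow n v) j0.
by rewrite prednK // expn_gt0 (ltn_trans _ n_gt1).
Qed.

(** Failure means a common root of f_a and f_a'. With this root as one extra coordinate,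
    [polyclosed_elim] shows that failure is a closed condition. *)
Lemma Zr_basic j a : (0 < j)%N -> Zr j a -> exists p, basic_nbhd (Zr j) a p.
Proof.
move=> j0 /no_multiple_rootP Za; have [d Fs] := perpoly_size_pred j0.
have FP := polyfam_perpoly R n j.
have Fm (v : nat -> C) : perpoly j (funrow n v) \is monic.
  by have [] := perpoly_monic_size n_gt1 (funrow n v) j0.
pose W := [set v : nat -> C | (perpoly j (funrow n v))^`().[v n] = 0].
have Wcl : polyclosed n.+1 W.
  apply: polyclosed_zero; apply: polyfam_horner; last exact: polyfunX.
  exact: polyfam_deriv (polyfam_leq (leqnSn n) FP).
have updE (v : nat -> C) x : perpoly j (funrow n (upd v n x)) = perpoly j (funrow n v).
  by apply: (polyfam_eq FP) => i im; rewrite /upd ltn_eqF.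
have [|p [pP pW pa]] := @polyclosed_elim _ _ _ _ _ FP Fm Fs Wcl (rowfun a).
  move=> [x]; rewrite /W /= updE /upd eqxx rowfunK => Fx F'x.
  by have := Za x Fx; rewrite F'x eqxx.
exists p; split=> //; first exact/eqP.
move=> b; apply: contra_neqP => /no_multiple_rootP/existsNP[x /not_implyP[Fx F'x]].
apply: pW; exists x; first by rewrite rowfunK.
rewrite /W /= updE /upd eqxx rowfunK; apply/eqP; exact: contra_notT F'x.
Qed.

Lemma Zset_basic a : Zset R n r a -> exists p, basic_nbhd (Zset R n r) a p.
Proof.
move=> Za.
have /choice[p pP] i : exists p, basic_nbhd (Zr (r i)) a p.
  by apply: Zr_basic => //; apply: Za.
exists (fun v => \prod_i p i v); split.
- by apply: polyfun_prod => i; have [] := pP i.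
- by rewrite prodf_seq_neq0; apply/allP => i _ /=; have [] := pP i.
move=> b; rewrite prodf_seq_neq0 => /allP pb i _; have [_ _] := pP i; apply.
by apply: pb; rewrite mem_index_enum.
Qed.

End Openness.

(** * Dependence of multipliers as a closed condition *)

Section DependentMultipliers.
Variables (R : realType) (n l : nat) (r : 'I_l -> nat).
Local Notation C := R[i].
Hypothesis n_gt1 : (1 < n)%N.
Hypothesis r_gt0 : forall i, (0 < r i)%N.
Implicit Types (a : 'rV[C]_n) (x : 'I_l -> C) (v : nat -> C).

(** By [scaled_gradMultE] this is (1 - M) times the gradient when y is a simple root; it is
    polynomial in (a, y) for all y. *)
Definition scaled_grad a j (y : C) (k : 'I_n) : C :=
  let g := monic_of a in
  dmult g 'X^k (diter g 'X^k 0 1 y j) (1 - (iter_poly g j)^`().[y]) y j.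

Definition dq a j (y z : C) : C := diffquo (n ^ j).+1 (perpoly j a) y z.

(* The polynomial equations saying, for roots x i of perpoly (r i) a with
   a in Zset, that the x i have exact period r i and distinct orbits and that
   the gradients of their multipliers are dependent. *)
Definition dependent_at a x : Prop :=
  [/\ forall (i : 'I_l) (k : 'I_(r i)), (0 < k)%N ->
        dq a (r i) (x i) (iter k (horner (monic_of a)) (x i)) = 0,
      forall (i j : 'I_l) (k : 'I_(r i)), i != j /\ r i = r j ->
        dq a (r i) (iter k (horner (monic_of a)) (x i)) (x j) = 0
    & forall B : 'M[C]_(n, l),
        \det ((\matrix_(i, k) scaled_grad a (r i) (x i) k) *m B) = 0].

(** The conditions are translated one by one. Comparing orbits relies on the exact periods: equal
    orbits have equal periods, so equations are needed only when r i = r j, where both points are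
    roots of the same polynomial. *)
Lemma dependent_atP a x : Zset R n r a ->
  (forall i, root (perpoly (r i) a) (x i)) ->
  dependent_at a x <->
  [/\ forall i, exact_period (monic_of a) (r i) (x i),
      forall i j, i != j ->
        orbit_of (monic_of a) (x i) <> orbit_of (monic_of a) (x j)
    & ~~ row_free (\matrix_(i < l) gradMult a (r i) (x i))].
Proof.
move=> Za Fx; set g := monic_of a.
have xr i : iter (r i) (horner g) (x i) = x i by apply/eqP; rewrite -root_iter_poly Fx.
have Zri i : no_multiple_root (perpoly (r i) a) by apply: Za.
have Fs i : (size (perpoly (r i) a) <= (n ^ r i).+1)%N.
  by have [_ ->] := perpoly_monic_size n_gt1 a (r_gt0 i).
have Fiter i k : root (perpoly (r i) a) (iter k (horner g) (x i)).
  by rewrite root_iter_poly -iterD addnC iterD xr.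
have perP : (forall (i : 'I_l) (k : 'I_(r i)), (0 < k)%N ->
    dq a (r i) (x i) (iter k (horner g) (x i)) = 0) <->
    forall i, exact_period g (r i) (x i).
  split=> [per i|per i k k0].
    split=> // k /andP[k0 kr] xk.
    by apply: (diffquo_roots_neq (Zri i) (Fs i) (Fx i) (Fiter i k)).1 (esym xk);
      apply: (per i (Ordinal kr)).
  apply/(diffquo_roots_neq (Zri i) (Fs i) (Fx i) (Fiter i k)) => xk.
  by have [_ _ /(_ k)] := per i; rewrite k0 ltn_ord -xk; apply.
have orbP : (forall i, exact_period g (r i) (x i)) ->
    (forall (i j : 'I_l) (k : 'I_(r i)), i != j /\ r i = r j ->
      dq a (r i) (iter k (horner g) (x i)) (x j) = 0) <->
    forall i j, i != j -> orbit_of g (x i) <> orbit_of g (x j).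
  move=> per; split=> [orb i j ij xij|orb i j k [ij rij]].
    have rij := exact_period_orbit_eq (per i) (per j) xij.
    have [k _ xk] : orbit_of g (x i) (x j) by rewrite xij; exists 0%N.
    (* Reduction modulo the period brings the iterate into the finite range of the equations. *)
    have kr : (k %% r i < r i)%N by rewrite ltn_mod.
    have Fxj : root (perpoly (r i) a) (x j) by rewrite rij.
    apply: ((diffquo_roots_neq (Zri i) (Fs i) (Fiter i (k %% r i)%N) Fxj).1
              (orb i j (Ordinal kr) (conj ij rij))).
    by rewrite -xk [in RHS](divn_eq k (r i)) addnC iterD iter_horner_periodic.
  have Fxj : root (perpoly (r i) a) (x j) by rewrite rij.
  apply/(diffquo_roots_neq (Zri i) (Fs i) (Fiter i k) Fxj) => xk.
  by apply: (orb i j ij); rewrite -xk (orbit_of_iter k (r_gt0 i)).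
have rowP : (forall B : 'M[C]_(n, l),
    \det ((\matrix_(i, k) scaled_grad a (r i) (x i) k) *m B) = 0) <->
    ~~ row_free (\matrix_(i < l) gradMult a (r i) (x i)).
  have sgP i k := scaled_gradMultE n_gt1 k (r_gt0 i) (Za i I) (Fx i).
  rewrite -row_free_det (@row_free_scale_rows _ _ _ _
    (\matrix_(i < l) gradMult a (r i) (x i))
    (fun i => 1 - (iter_poly g (r i))^`().[x i])) // => [i|i k].
    by have [] := sgP i (Ordinal (ltnW n_gt1)).
  by rewrite mxE [X in _ * X]mxE; have [_ ->] := sgP i k.
by split=> -[per orb row]; have per' := per; move: per per' => /perP per per';
  split; move=> //; do ?[exact/rowP|exact/orbP].
Qed.

(** The coefficients occupy the coordinates below n and the roots the next l; [polyclosed_exists]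
    projects the roots away. *)
Lemma dependent_at_closed : polyclosed n
  [set v | exists x, [/\ forall i, root (perpoly (r i) (funrow n v)) (x i) &
                         dependent_at (funrow n v) x]].
Proof.
(* Elimination is indexed by natural numbers; the value 1 out of range keeps the periods
   positive. *)
pose rr j := if insub j is Some i then r i else 1%N.
have rrE (i : 'I_l) : rr i = r i by rewrite /rr valK.
have rr_gt0 j : (0 < rr j)%N by rewrite /rr; case: insub.
pose xv v (i : 'I_l) : C := v (n + i)%N.
pose W := [set v | dependent_at (funrow n v) (xv v)].
have xP (i : 'I_l) : polyfun (n + l) (fun v => xv v i).
  by apply: polyfunX; rewrite ltn_add2l.
have gP := polyfam_leq (leq_addr l n) (polyfam_monic_of R n).
have FP j := polyfam_leq (leq_addr l n) (polyfam_perpoly R n j).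
have Wcl : polyclosed (n + l) W.
  have dqP i p q : polyfun (n + l) p -> polyfun (n + l) q ->
      polyfun (n + l) (fun v => dq (funrow n v) (r i) (p v) (q v)).
    by move=> pP qP; apply: polyfun_diffquo => //; apply: FP.
  have W12 := polyclosedI
    (polyclosed_forall (fun i => polyclosed_forall (fun k : 'I_(r i) =>
       polyclosed_forall (fun k0 : (0 < k)%N =>
         polyclosed_zero (dqP i _ _ (xP i) (polyfun_iter k (xP i)))))))
    (polyclosed_forall (fun i => polyclosed_forall (fun j =>
       polyclosed_forall (fun k : 'I_(r i) =>
         polyclosed_forall (fun ij : i != j /\ r i = r j =>
           polyclosed_zero (dqP i _ _ (polyfun_iter k (xP i)) (xP j))))))).
  have detP (B : 'M[C]_(n, l)) : polyfun (n + l) (fun v =>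
      \det ((\matrix_(i, k) scaled_grad (funrow n v) (r i) (xv v i) k) *m B)).
    apply: polyfun_det => i j.
    apply: (@polyfun_ext _ _ _ (fun v => \sum_k
       scaled_grad (funrow n v) (r i) (xv v i) k * B k j)) => [v|].
      by rewrite mxE; apply: eq_bigr => k _; rewrite mxE.
    apply: polyfun_sum => k; apply: polyfunM; last exact: polyfunC.
    apply: polyfun_dmult => //.
      by apply: polyfun_diter => //; apply: polyfunC.
    apply: polyfunB; first exact: polyfunC.
    apply: polyfam_horner => //; apply: polyfam_deriv.
    exact: polyfam_leq (leq_addr l n) (polyfam_iter_poly R n (r i)).
  have W3 := polyclosed_forall (fun B => polyclosed_zero (detP B)).
  move: (polyclosedI W12 W3); congr polyclosed.
  by apply/seteqP; split=> v /= => [[[per orb] det]|[per orb det]]; do ?split.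
have FrP j : (j < l)%N -> [/\ polyfam n (fun v => perpoly (rr j) (funrow n v)),
    forall v, perpoly (rr j) (funrow n v) \is monic &
    exists d, forall v, size (perpoly (rr j) (funrow n v)) = d.+2].
  move=> _; split; first exact: polyfam_perpoly.
    by move=> v; have [] := perpoly_monic_size n_gt1 (funrow n v) (rr_gt0 j).
  exact: perpoly_size_pred.
move: (polyclosed_exists FrP Wcl); congr polyclosed; apply/seteqP; split=> v /=.
  move=> [w [wv Fw Ww]]; exists (xv w).
  have <- : funrow n w = funrow n v by apply/rowP => i; rewrite !mxE wv.
  split=> // i; have := Fw i (ltn_ord i); rewrite rrE.
  by congr (is_true (root (perpoly _ _) _)); apply/rowP => k; rewrite !mxE wv.
move=> [x [Fx Wx]].
(* Appends the tuple of roots to v. *)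
pose w j := if (j < n)%N then v j else
            if insub (j - n)%N is Some i then x i else 0.
have wv j : (j < n)%N -> w j = v j by rewrite /w => ->.
have wx (i : 'I_l) : w (n + i)%N = x i.
  by rewrite /w ltnNge leq_addr /= addKn valK.
have wE : funrow n w = funrow n v by apply/rowP => i; rewrite !mxE wv.
exists w; split=> //; last by rewrite /W /= wE (_ : xv w = x) //; apply: funext.
by move=> j jl; rewrite (rrE (Ordinal jl)) (wx (Ordinal jl)).
Qed.

Lemma Z0setE : Z0set R n r = Zset R n r `&`
  ~` [set a | exists x, [/\ forall i, root (perpoly (r i) a) (x i) &
                            dependent_at a x]].
Proof.
apply/seteqP; split=> a [Za Ha]; split=> //.
  move=> [x [Fx]]; rewrite dependent_atP // => -[xper xorb] /negP; apply.
  exact: Ha.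
move=> x xper xorb; apply/negPn/negP => nfree; apply: Ha; exists x.
have Fx i : root (perpoly (r i) a) (x i).
  by rewrite root_iter_poly; have [_ /eqP] := xper i.
by split=> //; apply/dependent_atP.
Qed.

End DependentMultipliers.

(** * Openness, density and the polynomial x^n *)

Theorem corollary1p7 (R : realType) (n l : nat) (r : 'I_l -> nat)
  (hn : (3 <= n)%N) (hl : (0 < l)%N) (hr : forall i, (0 < r i)%N)
  (hsum : (\sum_(i < l) r i <= n)%N)
  (hsum1 : (exists j, r j = 1%N) -> (\sum_(i < l) r i < n)%N) :
  [/\ zariski_open_in (Zset R n r) (Z0set R n r),
      zariski_dense_in (Zset R n r) (Z0set R n r)
    & exists2 a : 'rV[R[i]]_n, monic_of a = 'X^n & Z0set R n r a].
Proof.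
have n_gt1 : (1 < n)%N by apply: ltnW.
have Z0E := Z0setE R n_gt1 hr.
set U := ~` _ in Z0E.
have Uopen : zariski_open U.
  have := zariski_closed_polyclosed (@dependent_at_closed R _ _ _ n_gt1 hr).
  rewrite /zariski_open; congr zariski_closed.
  by apply/seteqP; split=> a /=; rewrite rowfunK; [move=> ?; apply|apply: contrapT].
(* The zero vector represents x^n; it also shows that U is nonempty. *)
have Z00 : Z0set R n r (0 : 'rV_n).
  split=> [i _|x]; first exact: Zr_Xn.
  by rewrite monic_of0 => xper xorb; apply: gradMult_Xn_row_free.
split; first by exists U.
  split=> [a|V Vopen [z [Zz Vz]]]; first by rewrite Z0E => -[].
  (* Irreducibility: principal open sets around z, inside Z and V, and around 0, inside U, have a
     common point. *)
  have [pz pzP] := Zset_basic n_gt1 hr Zz.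
  have [pV pVP] := zariski_open_basic Vopen Vz.
  have [|pU pUP] := @zariski_open_basic _ _ U 0 Uopen; first by move: Z00; rewrite Z0E => -[].
  have [a [[Za Va] Ua]] := basic_nbhd_common (basic_nbhdI pzP pVP) pUP.
  by exists a; rewrite Z0E; split.
by exists 0; first exact: monic_of0.
Qed.
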